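(* Let $K$ be a compact line, $L$ be a compact Hausdorff space and $\phi:K\to L$ be a continuous surjection. Let $(L_\gamma)_{\gamma\in\Gamma}$ be a disjoint family of clopen subsets of $L$ such that $L\setminus\big(\bigcup_{\gamma\in\Gamma}L_\gamma\big)$ has at most one point. Set $K_\gamma=\phi^{-1}[L_\gamma]$ and $\phi_\gamma=\phi\vert_{K_\gamma}:K_\gamma\to L_\gamma$. Let $\lambda\ge2$ and assume that $(\phi_\gamma)^*C(L_\gamma)$ has the $c_0$-extension property with constant $\lambda$ in $C(K_\gamma)$, for all $\gamma\in\Gamma$. Then, for any $\varepsilon>0$, $\phi^*C(L)$ has the $c_0$-extension property with constant $\lambda+\varepsilon$ in $C(K)$.
   Context: All Banach spaces are real. A compact line is a linearly ordered set which is compact in the order topology. For a compact Hausdorff space $K$, $C(K)$ denotes the Banach space of real-valued continuous functions on $K$ with the supremum norm. For a continuous map $\phi:K\to L$ between compact Hausdorff spaces, $\phi^*:C(L)\to C(K)$ is the composition map $f\mapsto f\circ\phi$, and $\phi^*C(L)$ denotes its range (when $\phi$ is onto, $\phi^*$ is an isometric embedding, so the range is a closed subspace). Given $\lambda\ge1$, a closed subspace $Y$ of a Banach space $X$ has the $c_0$-extension property with constant $\lambda$ in $X$ if every bounded linear operator $T:Y\to c_0$ admits a bounded linear extension $T':X\to c_0$ with $\Vert T'\Vert\le\lambda\Vert T\Vert$. *)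

(* Defs.v *)
From HB Require Import structures.
From mathcomp Require Import all_boot all_order all_algebra.
From mathcomp Require Import all_classical all_reals.
From mathcomp Require Import topology normedtype sequences.

Set Implicit Arguments.
Unset Strict Implicit.
Unset Printing Implicit Defensive.

Import Order.TTheory GRing.Theory Num.Theory.
Import numFieldNormedType.Exports.

Local Open Scope classical_set_scope.
Local Open Scope ring_scope.

HB.mixin Record isCompact T & Topological T := {
  compact_setT : compact [set: T]
}.

#[short(type="compactType")]
HB.structure Definition Compact := {T of Topological T & isCompact T}.

#[short(type="compactLineType")]
HB.structure Definition CompactLine d :=
  {T of OrderTopological d T & isCompact T}.

(* When I is empty this is sup set0 = 0, as it should be. *)
Definition supnorm (R : realType) (I : Type) (f : I -> R) : R :=
  sup (range (fun i => `|f i|)).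

Section SupNorm.
Context (R : realType) (I : Type).
Implicit Types f g : I -> R.

Definition ubounded f := exists M : R, forall i, `|f i| <= M.

Lemma supnorm_ub f i : ubounded f -> `|f i| <= supnorm f.
Proof.
move=> [M fM]; apply: ub_le_sup; last by exists i.
by exists M => _ [j _ <-].
Qed.

Lemma supnorm_le f (M : R) : 0 <= M -> (forall i, `|f i| <= M) ->
  supnorm f <= M.
Proof.
move=> M0 fM; rewrite /supnorm.
have [->|/set0P ne] := eqVneq (range (fun i => `|f i|)) set0.
  by rewrite sup0.
by apply: ge_sup => // _ [i _ <-].
Qed.

Lemma supnorm_ge0 f : 0 <= supnorm f.
Proof.
rewrite /supnorm; set S : set R := [set _ | _ in _].
have [hS|/sup_out ->//] := pselect (has_sup S).
have [[_ [i _ _]] uS] := hS.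
exact: le_trans (normr_ge0 (f i)) (ub_le_sup uS (imageT _ i)).
Qed.

Lemma supnormD f g : ubounded f -> ubounded g ->
  supnorm (fun i => f i + g i) <= supnorm f + supnorm g.
Proof.
move=> bf bg; apply: supnorm_le; first by rewrite addr_ge0 ?supnorm_ge0.
by move=> i; rewrite (le_trans (ler_normD _ _))// lerD ?supnorm_ub.
Qed.

Lemma supnormZ (a : R) f : ubounded f ->
  supnorm (fun i => a * f i) = `|a| * supnorm f.
Proof.
have le b h : ubounded h -> supnorm (fun i => b * h i) <= `|b| * supnorm h.
  move=> bh; apply: supnorm_le; first by rewrite mulr_ge0 ?supnorm_ge0.
  by move=> i; rewrite normrM ler_wpM2l ?supnorm_ub.
move=> bf; apply/eqP; rewrite eq_le le//=.
have [->|a0] := eqVneq a 0; first by rewrite normr0 mul0r supnorm_ge0.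
have baf : ubounded (fun i => a * f i).
  by case: bf => M fM; exists (`|a| * M) => i; rewrite normrM ler_wpM2l.
rewrite -ler_pdivlMl ?normr_gt0// -normfV.
rewrite [leLHS](_ : _ = supnorm (fun i => a^-1 * (a * f i))) ?le//.
by congr supnorm; apply/funext => i; rewrite mulKf.
Qed.

Lemma supnorm0_eq0 f : ubounded f -> supnorm f = 0 -> f = (fun=> 0).
Proof.
move=> bf f0; apply/funext => i; apply/eqP.
by rewrite -normr_le0 -f0 supnorm_ub.
Qed.

End SupNorm.

Section ContinuousFunctions.
Context (R : realType) (K : topologicalType).

Definition ctspred : {pred K -> R} := fun f => `[< continuous f >].

(* C(K): the library type of continuous maps, made a subtype of the module
   K -> R so that it inherits the pointwise operations. *)
Definition cfun_type : Type := continuousType K R.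
HB.instance Definition _ := Choice.on cfun_type.

Definition cfun_val (f : cfun_type) : K -> R := f.

Definition cfun_Sub (f : K -> R) (cf : f \in ctspred) : cfun_type :=
  mkcts (asboolW cf).

Lemma cfun_rect (P : cfun_type -> Type) :
  (forall f (cf : f \in ctspred), P (cfun_Sub cf)) -> forall f, P f.
Proof.
move=> Pf f; have cf : (f : K -> R) \in ctspred by apply/asboolP/cts_fun.
suff -> : f = cfun_Sub cf by exact: Pf.
exact/continuousEP.
Qed.

Lemma cfun_SubK f (cf : f \in ctspred) : cfun_val (cfun_Sub cf) = f.
Proof. by []. Qed.

HB.instance Definition _ :=
  isSub.Build _ _ cfun_type cfun_rect cfun_SubK.

Lemma ctspred_submod : submod_closed ctspred.
Proof.
split; first by apply/asboolP => x; exact: cvg_cst.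
move=> a f g /asboolP cf /asboolP cg; apply/asboolP => x.
by apply: cvgD; [apply: cvgMr; exact: cf | exact: cg].
Qed.
HB.instance Definition _ :=
  GRing.isSubmodClosed.Build R (K -> R) ctspred ctspred_submod.
HB.instance Definition _ := [SubChoice_isSubLmodule of cfun_type by <:].


End ContinuousFunctions.

Section ContinuousNorm.
Context (R : realType) (K : compactType).
Local Notation CK := (cfun_type R K).

Lemma cfun_ubounded (f : CK) : ubounded (f : K -> R).
Proof.
have : compact (range (f : K -> R)).
  apply: (continuous_compact _ compact_setT).
  by apply: continuous_subspaceT; exact: cts_fun.
move=> /compact_bounded/pinfty_ex_gt0 [M _ fM]; exists M => i; apply: fM.
by exists i.
Qed.

Let norm (f : CK) : R := supnorm (f : K -> R).

Let normD (f g : CK) : norm (f + g) <= norm f + norm g.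
Proof. exact: supnormD (cfun_ubounded f) (cfun_ubounded g). Qed.

Let normZ (a : R) (f : CK) : norm (a *: f) = `|a| * norm f.
Proof. by rewrite -(supnormZ a (cfun_ubounded f)). Qed.

Let norm0_eq0 (f : CK) : norm f = 0 -> f = 0.
Proof.
by move=> /(supnorm0_eq0 (cfun_ubounded f)) f0; apply: val_inj.
Qed.

HB.instance Definition _ :=
  Lmodule_isNormed.Build R CK normD normZ norm0_eq0.

Lemma cfun_normE (f : CK) : `|f| = supnorm (f : K -> R).
Proof. by []. Qed.

End ContinuousNorm.

Section NullSequences.
Context (R : realType).

Definition c0pred : {pred nat -> R} := fun u => `[< u @ \oo --> (0 : R) >].

Lemma c0pred_submod : submod_closed c0pred.
Proof.
split; first by apply/asboolP; exact: cvg_cst.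
move=> a u v /asboolP cu /asboolP cv; apply/asboolP.
suff : (a *: u + v) @ \oo --> a * 0 + (0 : R) by rewrite mulr0 addr0.
by apply: cvgD => //; exact: cvgMr.
Qed.
HB.instance Definition _ :=
  GRing.isSubmodClosed.Build R (nat -> R) c0pred c0pred_submod.

Definition c0 : Type := {u : nat -> R | u \in c0pred}.
HB.instance Definition _ := SubType.on c0.
HB.instance Definition _ := Choice.on c0.
HB.instance Definition _ := [SubChoice_isSubLmodule of c0 by <:].

Lemma c0_ubounded (u : c0) : ubounded (val u).
Proof.
have /asboolP cu := valP u.
have /cvg_seq_bounded/pinfty_ex_gt0 [M _ uM] : cvgn (val u).
  by apply/cvg_ex; exists 0.
by exists M => i; exact: uM.
Qed.

Let norm (u : c0) : R := supnorm (val u).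

Let normD (u v : c0) : norm (u + v) <= norm u + norm v.
Proof. exact: supnormD (c0_ubounded u) (c0_ubounded v). Qed.

Let normZ (a : R) (u : c0) : norm (a *: u) = `|a| * norm u.
Proof. by rewrite -(supnormZ a (c0_ubounded u)). Qed.

Let norm0_eq0 (u : c0) : norm u = 0 -> u = 0.
Proof.
by move=> /(supnorm0_eq0 (c0_ubounded u)) u0; apply: val_inj.
Qed.

HB.instance Definition _ :=
  Lmodule_isNormed.Build R c0 normD normZ norm0_eq0.

Lemma c0_normE (u : c0) : `|u| = supnorm (val u).
Proof. by []. Qed.

End NullSequences.

Section Subspaces.
Context (R : realType) (X : normedModType R) (Y : submodClosed X).

Definition subspace_type : Type := {x : X | x \in Y}.
HB.instance Definition _ := SubType.on subspace_type.
HB.instance Definition _ := Choice.on subspace_type.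
HB.instance Definition _ := [SubChoice_isSubLmodule of subspace_type by <:].

Let norm (y : subspace_type) : R := `|val y|.

Let normD (x y : subspace_type) : norm (x + y) <= norm x + norm y.
Proof. exact: ler_normD. Qed.

Let normZ (a : R) (y : subspace_type) : norm (a *: y) = `|a| * norm y.
Proof. exact: normrZ. Qed.

Let norm0_eq0 (y : subspace_type) : norm y = 0 -> y = 0.
Proof. by move=> /normr0_eq0 y0; apply: val_inj. Qed.

HB.instance Definition _ :=
  Lmodule_isNormed.Build R subspace_type normD normZ norm0_eq0.

Lemma subspace_normE (y : subspace_type) : `|y| = `|val y|.
Proof. by []. Qed.

End Subspaces.

(* Only meaningful for bounded T: otherwise sup takes its default value 0. *)
Definition opnorm (R : realType) (V W : normedModType R) (T : {linear V -> W})
  : R := sup [set `|T x| | x in [set x | `|x| <= 1]].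

(* Stated for any linear subspace Y; closedness of Y plays no role in the
   formula. *)
Definition c0_extension_property (R : realType) (X : normedModType R)
    (Y : submodClosed X) (lambda : R) : Prop :=
  forall T : {linear subspace_type Y -> c0 R}, bounded_fun_norm T ->
  exists T' : {linear X -> c0 R},
    [/\ bounded_fun_norm T', forall y, T' (val y) = T y &
        opnorm T' <= lambda * opnorm T].

Section Pullback.
Context (R : realType) (K L : compactType) (phi : continuousType K L).

Definition pullback (f : cfun_type R L) : cfun_type R K :=
  [the continuousType K R of f \o phi].

Lemma pullback_linear : linear pullback.
Proof. by move=> a f g; apply: val_inj. Qed.
HB.instance Definition _ :=
  GRing.isLinear.Build R (cfun_type R L) (cfun_type R K) _ pullback
    pullback_linear.

Definition pullback_range : {pred cfun_type R K} :=
  fun f => `[< range pullback f >].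

Lemma pullback_range_submod : submod_closed pullback_range.
Proof.
split; first by apply/asboolP; exists 0 => //; rewrite linear0.
move=> a _ _ /asboolP[f _ <-] /asboolP[g _ <-]; apply/asboolP.
by exists (a *: f + g) => //; rewrite linearP.
Qed.
HB.instance Definition _ :=
  GRing.isSubmodClosed.Build R (cfun_type R K) pullback_range
    pullback_range_submod.

End Pullback.

Arguments pullback R {K L} phi f.
Arguments pullback_range R {K L} phi _.

(* For an onto phi the range of phi^* is closed, so the closed-subspace proviso
   of the c_0-extension property is met. *)
Lemma pullback_range_closed (R : realType) (K L : compactType)
    (phi : continuousType K L) : hausdorff_space L ->
  set_surj [set: K] [set: L] phi ->
  closed [set f | f \in pullback_range R phi].
Proof.
move=> hL sphi f clf.
have fphi x y : phi x = phi y -> f x = f y.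
  move=> xy; apply/eqP; rewrite -subr_eq0 -normr_le0.
  apply/ler_addgt0Pr => e e0; rewrite add0r.
  have [] := clf (ball f (e / 2)); first by apply: nbhsx_ballx; rewrite divr_gt0.
  move=> h [/asboolP[g _ <-]]; rewrite -ball_normE /= => fge.
  have d z : `|f z - g (phi z)| <= e / 2.
    apply/ltW/(le_lt_trans _ fge).
    exact: (supnorm_ub z (cfun_ubounded (f - pullback R phi g))).
  rewrite (splitr e) -(subrKA (g (phi x))) {2}xy.
  by rewrite (le_trans (ler_normD _ _))// lerD// distrC.
have /choice[s phis] : forall l, exists x, phi x = l.
  by move=> l; have [x _ <-] := sphi l Logic.I; exists x.
have cg : continuous ((f : K -> R) \o s).
  apply/continuous_closedP => C cC.
  rewrite (_ : _ @^-1` C = phi @` ((f : K -> R) @^-1` C)).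
    apply: compact_closed => //; apply: continuous_compact.
      by apply: continuous_subspaceT; exact: cts_fun.
    apply: (subclosed_compact _ (@compact_setT K)) => //.
    by apply: preimage_closed => // x _; exact: (@cts_fun _ _ f).
  apply/seteqP; split => [l Cl|_ [x Cx <-]]; first by exists (s l).
  by rewrite /preimage/= (fphi _ x).
apply/asboolP; exists [the continuousType L R of mkcts cg] => //.
by apply/continuousEP => x /=; apply: fphi; rewrite phis.
Qed.

Section ClopenSubspace.
Context (T : topologicalType) (A : set T).

(* The subspace A, with the clopenness proof kept as a parameter so that
   compactness can be inherited canonically from the ambient space. *)
Definition clopen_type (cA : clopen A) : Type := set_type A.
HB.instance Definition _ (cA : clopen A) :=
  Topological.copy (clopen_type cA) (set_type A).

End ClopenSubspace.

Section ClopenCompact.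
Context (T : compactType) (A : set T) (cA : clopen A).

Lemma clopen_type_compact : compact [set: clopen_type cA].
Proof.
move=> F FF _; pose v : clopen_type cA -> T := set_val.
have cptA : compact A.
  exact: (subclosed_compact cA.2 (@compact_setT T)).
have FA : (v @ F) A.
  by apply: (@filterS _ F _ setT) => [x _|]; [exact: set_valP|exact: filterT].
have [p [Ap clp]] := cptA _ _ FA.
exists (exist _ p (mem_set Ap)); split => // U V FU.
move=> [_ [[W oW <-] Wp] sWV].
have FvU : (v @ F) (v @` U).
  by apply: (@filterS _ F _ U) => [x Ux|//]; exists x.
have pW : nbhs p W by exact: open_nbhs_nbhs.
have [_ [[x Ux <-] Wx]] := clp _ _ FvU pW.
by exists x; split => //; exact: sWV.
Qed.
HB.instance Definition _ := isCompact.Build (clopen_type cA) clopen_type_compact.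

End ClopenCompact.

Section RestrictPreimage.
Context (K L : topologicalType) (phi : continuousType K L).
Context (A : set L) (cA : clopen A).

Definition clopen_preimage : clopen (phi @^-1` A) :=
  preimage_clopen cA (@cts_fun _ _ phi).

Definition restrict_preimage (x : clopen_type clopen_preimage) :
    clopen_type cA :=
  exist _ (phi (val x)) (mem_set (set_valP x)).

Lemma restrict_preimage_continuous : continuous restrict_preimage.
Proof.
apply: (@continuous_comp_initial _ _ _ (set_val : A -> L)) => x.
have -> : set_val \o restrict_preimage = phi \o set_val by [].
apply: continuous_comp; last exact: cts_fun.
exact: (@initial_continuous _ _ (set_val : (phi @^-1` A) -> K)).
Qed.
HB.instance Definition _ :=
  isContinuous.Build _ _ restrict_preimage restrict_preimage_continuous.

End RestrictPreimage.

Arguments restrict_preimage {K L} phi {A} cA x.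

(* Main.v *)
Require Import Defs.
From HB Require Import structures.
From mathcomp Require Import all_boot all_order all_algebra.
From mathcomp Require Import all_classical all_reals.
From mathcomp Require Import topology normedtype sequences.
From mathcomp Require Import ring lra.

Set Implicit Arguments.
Unset Strict Implicit.
Unset Printing Implicit Defensive.

Import Order.TTheory GRing.Theory Num.Theory.
Import numFieldNormedType.Exports.

Local Open Scope classical_set_scope.
Local Open Scope ring_scope.

(** An operator into c_0 is a weak-star null sequence of functionals tau n. On
    C(L) each tau n splits along the clopen pieces L_gamma, its masses on
    disjoint pieces adding up to at most its norm. Two extensions to C(K) are
    available. Over one piece the extension property gives one that is again
    weak-star null, of norm at most lambda times the mass, up to a summable
    slack, since tau n may first be normalized by its mass on that piece
    (local_extension). Over all pieces at once Hahn and Banach give an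
    extension rho n of the same norm (hahn_banach_pullback), with no control
    on convergence.

    If p is the point of L outside the pieces and F its fibre, the compact line
    K retracts onto F by a continuous map r that is locally constant off F
    (compact_line_retraction): each gap of F is cut in two by a clopen initial
    segment, and the halves are sent to the endpoints. Write P f for f \o r.
    Every f - P f is small away from finitely many pieces, so that
    rho n (f - P f) tends to 0 as soon as rho n carries the mass of tau n
    on pieces of larger and larger index only; this correction costs a factor
    2, which is where lambda >= 2 enters. Hence the first N n pieces are
    extended by local_extension and the others by f |-> rho n (f - P f), with
    N n tending to infinity (glue_extensions).

    The first part must also be weak-star null on the functions P f, which
    in general have no countable dense subset. But r takes only finitely many values
    over one piece, so P has finite rank there, pointwise convergence becomes
    norm convergence (opnorm_finite_rank_cvg), and a slow enough growth of N n
    suffices (slow_growth). Finally only countably many pieces matter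
    (countable_support), which makes the summable slack possible. *)

(** * Bounded operators and norm preserving extensions *)

Section OperatorNorm.
Context (R : realType) (V W : normedModType R).
Implicit Types T : {linear V -> W}.

(** One bound for all vectors; bounded_fun_norm has one for the image of each
    ball instead. *)
Definition norm_bounded T := exists M, forall x, `|T x| <= M * `|x|.

Lemma norm_boundedP T : bounded_fun_norm T <-> norm_bounded T.
Proof.
split=> [bT|[M TM] r].
  have [M TM] := bT 1; exists M => x.
  have [->|x0] := eqVneq x 0; first by rewrite linear0 !normr0 mulr0.
  have nx : 0 < `|x| by rewrite normr_gt0.
  have /TM : `| (`|x|^-1) *: x| <= 1.
    by rewrite normrZ normfV normr_id mulVf ?gt_eqF.
  by rewrite linearZ normrZ normfV normr_id ler_pdivrMl// mulrC.
exists (`|M| * r) => x xr; apply: le_trans (TM x) _.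
by apply: (le_trans (ler_wpM2r _ (ler_norm M))) => //; rewrite ler_wpM2l.
Qed.

Lemma opnorm_le T M : 0 <= M -> (forall x, `|T x| <= M * `|x|) ->
  opnorm T <= M.
Proof.
move=> M0 TM; apply: ge_sup; first by exists `|T 0|, 0 => //=; rewrite normr0.
move=> _ [x /= x1 <-]; apply: le_trans (TM x) _.
by rewrite -[leRHS]mulr1 ler_wpM2l.
Qed.

Lemma opnorm_has_sup T : norm_bounded T ->
  has_sup [set `|T x| | x in [set x | `|x| <= 1]].
Proof.
move=> [M TM]; split; first by exists `|T 0|, 0 => //=; rewrite normr0.
exists `|M| => _ [x /= x1 <-]; apply: le_trans (TM x) _.
apply: (le_trans (ler_wpM2r _ (ler_norm M))) => //.
by rewrite -[leRHS]mulr1 ler_wpM2l.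
Qed.

Lemma opnorm_ub T : norm_bounded T -> forall x, `|T x| <= opnorm T * `|x|.
Proof.
move=> bT x; have [->|x0] := eqVneq x 0.
  by rewrite linear0 !normr0 mulr0.
have nx : 0 < `|x| by rewrite normr_gt0.
rewrite -ler_pdivrMr//.
have -> : `|T x| / `|x| = `|T (`|x|^-1 *: x)|.
  by rewrite linearZ normrZ normfV normr_id mulrC.
apply: ub_le_sup; first by case: (opnorm_has_sup bT).
by eexists; last reflexivity; rewrite /= normrZ normfV normr_id mulVf ?gt_eqF.
Qed.

Lemma opnorm_ge0 T : norm_bounded T -> 0 <= opnorm T.
Proof.
move=> bT; apply: le_trans (normr_ge0 (T 0)) _; apply: ub_le_sup.
  by case: (opnorm_has_sup bT).
by exists 0 => //=; rewrite normr0.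
Qed.

End OperatorNorm.

Section Functionals.
Context (R : realType) (X : normedModType R).
Implicit Types t : {linear X -> R^o}.

Definition functional (F : X -> R) (linF : scalar F) : {linear X -> R^o} :=
  HB.pack (F : X -> R^o) (GRing.isLinear.Build R X R^o *:%R F linF).

(** The codomain being the field, a vector that almost attains the norm can be
    replaced by its opposite, so no absolute value is needed. *)
Lemma opnorm_approx t (e : R) : norm_bounded t -> 0 < e ->
  exists2 x, `|x| <= 1 & opnorm t - e < t x.
Proof.
move=> bt e0; have [_ [x /= x1 <-] xe] := sup_adherent e0 (opnorm_has_sup bt).
have [tx0|tx0] := leP 0 (t x).
  by exists x => //; rewrite ger0_norm in xe.
by exists (- x); rewrite ?normrN// linearN; rewrite ltr0_norm in xe.
Qed.

(** The functional to be extended is given by its graph G0, and Zorn's lemma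
    is applied to sets of pairs rather than to partial functions: a linear
    relation dominated by the norm is automatically single-valued, since
    (0, a) in it forces a <= 0 and - a <= 0. *)
Lemma hahn_banach (G0 : set (X * R)) (M : R) : 0 <= M ->
  G0 !=set0 ->
  (forall (c : R) p q, G0 p -> G0 q -> G0 (c *: p.1 + q.1, c * p.2 + q.2)) ->
  (forall p, G0 p -> p.2 <= M * `|p.1|) ->
  exists t : {linear X -> R^o},
    (forall p, G0 p -> t p.1 = p.2) /\ (forall x, `|t x| <= M * `|x|).
Proof.
move=> M0 G0n G0l G0M.
pose adm (G : set (X * R)) := [/\
  (forall (c : R) p q, G p -> G q -> G (c *: p.1 + q.1, c * p.2 + q.2)),
  (forall p, G p -> p.2 <= M * `|p.1|) & (G !=set0 -> G0 `<=` G)].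
(* Containing G0 is only asked of nonempty graphs, so that the union of the
   empty chain is admissible. *)
have [|G [[Gl GM Gn] Gmax]] := @Zorn_bigcup _ adm.
  move=> Fc Fadm Ftot; split.
  - move=> c p q [A FA Ap] [B FB Bq].
    have [AB|BA] := Ftot A B FA FB.
      by have [Bl _ _] := Fadm B FB; exists B => //; apply: Bl => //; exact: AB.
    by have [Al _ _] := Fadm A FA; exists A => //; apply: Al => //; exact: BA.
  - by move=> p [A FA Ap]; have [_ + _] := Fadm A FA; exact.
  - move=> [p [A FA Ap]] q G0q; exists A => //.
    by have [_ _] := Fadm A FA; apply => //; exists p.
have adm0 : adm G0.
  by split=> // _ x.
have Gn0 : G !=set0.
  apply/set0P/eqP => G0'; apply: (Gmax G0) adm0.
  rewrite G0'; split=> [p []//|G00]; have [p Gp] := G0n; exact: (G00 p Gp).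
have G0G := Gn Gn0.
have Gz : G (0, 0).
  by have [p Gp] := Gn0; have := Gl (-1) _ _ Gp Gp;
    rewrite scaleN1r mulN1r !addNr.
have Gfun x a b : G (x, a) -> G (x, b) -> a = b.
  move=> Ga Gb; apply/eqP; rewrite eq_le; apply/andP; split.
    have := GM _ (Gl (-1) _ _ Gb Ga).
    by rewrite /= scaleN1r addNr normr0 mulr0; lra.
  have := GM _ (Gl (-1) _ _ Ga Gb).
  by rewrite /= scaleN1r addNr normr0 mulr0; lra.
have Gtot v : exists a, G (v, a).
  apply: contrapT => nv.
  (* The value at v must lie above all of S and below all the bounds
     M * |q.1 + v| - q.2; the triangle inequality makes these compatible. *)
  pose S := [set p.2 - M * `|p.1 - v| | p in G].
  have Sub q : G q -> ubound S (M * `|q.1 + v| - q.2).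
    move=> Gq _ [p Gp <-].
    have := GM _ (Gl 1 _ _ Gp Gq); rewrite /= scale1r mul1r => h.
    have : M * `|p.1 + q.1| <= M * (`|p.1 - v| + `|q.1 + v|).
      rewrite ler_wpM2l// (le_trans _ (ler_normD _ _))// (_ : p.1 - v + _ = p.1 + q.1)//.
      by rewrite addrACA addNr addr0.
    by rewrite mulrDr; lra.
  have hS : has_sup S.
    split; first by exists ((0:R) - M * `|(0:X) - v|), (0, 0).
    by exists (M * `|(0:X) + v| - 0); exact: (Sub (0, 0)).
  pose al := sup S.
  have al1 p : G p -> p.2 - M * `|p.1 - v| <= al.
    by move=> Gp; apply: ub_le_sup; [case: hS|exists p].
  have al2 q : G q -> al <= M * `|q.1 + v| - q.2.
    by move=> /Sub; apply: ge_sup; case: hS.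
  pose G' := [set r : X * R | exists c p, G p /\ r = (p.1 + c *: v, p.2 + c * al)].
  have GG' : G `<=` G'.
    by move=> [x a] Gp; exists 0, (x, a); rewrite scale0r mul0r !addr0.
  have GsG' : G `<` G'.
    split=> // G'G; apply: nv; exists al; apply: G'G.
    by exists 1, (0, 0); rewrite scale1r mul1r !add0r.
  apply: (Gmax _ GsG'); split.
  - move=> c _ _ [d [p [Gp ->]]] [e [q [Gq ->]]] /=.
    exists (c * d + e), (c *: p.1 + q.1, c * p.2 + q.2); split; first exact: Gl.
    congr pair => /=; first by rewrite scalerDl scalerDr scalerA addrACA.
    by ring.
  - move=> _ [c [p [Gp ->]]] /=.
    have [c0|c0|->] := ltgtP c 0; last by rewrite scale0r mul0r !addr0 GM.
    + have c1 : 0 < - c by rewrite oppr_gt0.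
      have := al1 _ (Gl (- c)^-1 _ _ Gp Gz); rewrite /= !addr0 => h.
      have -> : p.1 + c *: v = (- c) *: ((- c)^-1 *: p.1 - v).
        rewrite scalerBr scalerA divff ?gt_eqF// scale1r scaleNr opprK//.
      rewrite normrZ gtr0_norm// mulrCA.
      have -> : p.2 + c * al = (- c) * ((- c)^-1 * p.2 - al).
        by rewrite mulrBr mulrA divff ?gt_eqF//; ring.
      by rewrite ler_pM2l//; lra.
    + have := al2 _ (Gl c^-1 _ _ Gp Gz); rewrite /= !addr0 => h.
      have -> : p.1 + c *: v = c *: (c^-1 *: p.1 + v).
        by rewrite scalerDr scalerA divff ?gt_eqF// scale1r.
      rewrite normrZ gtr0_norm// mulrCA.
      have -> : p.2 + c * al = c * (c^-1 * p.2 + al).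
        by rewrite mulrDr mulrA divff ?gt_eqF// mul1r.
      by rewrite ler_pM2l//; lra.
  - by move=> _; exact: subset_trans GG'.
have [F FG] := choice Gtot.
have linF : scalar F by move=> c x y;
  exact: Gfun (FG _) (Gl c _ _ (FG x) (FG y)).
exists (functional linF); split=> [[x a] /G0G Gp|x]; first exact: Gfun Gp.
rewrite ler_norml; apply/andP; split; last exact: (GM _ (FG x)).
have := GM _ (FG (- x)); rewrite /= normrN.
have -> : F (- x) = - F x by exact: (linearN (functional linF)).
lra.
Qed.

End Functionals.

(** * Cutting continuous functions off along clopen sets *)

Lemma continuous_at_near (X Y : topologicalType) (f g : X -> Y) (U : set X) x :
  open U -> U x -> {in U, f =1 g} -> {for x, continuous g} ->
  {for x, continuous f}.
Proof.
move=> oU Ux fg cg; rewrite /prop_for /= /continuous_at (fg _ (mem_set Ux)).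
apply: cvg_trans cg; apply: near_eq_cvg.
apply: filterS (open_nbhs_nbhs (conj oU Ux)) => y Uy.
by rewrite fg ?inE.
Qed.

Section ClopenRestriction.
Context (R : realType) (X : topologicalType).
Local Notation CX := (cfun_type R X).

(** Multiplication by the indicator of A. It is made total in A, with value 0
    when A is not clopen, so that it can be composed as a linear map without
    carrying a proof. *)
Definition cutoff_fun (A : set X) (f : CX) : X -> R :=
  fun x => if `[< clopen A /\ A x >] then (f : X -> R) x else 0.

Lemma cutoff_fun_continuous A f : continuous (cutoff_fun A f).
Proof.
have [cA|ncA] := pselect (clopen A); last first.
  have -> : cutoff_fun A f = fun=> 0.
    by apply/funext => x; rewrite /cutoff_fun; case: asboolP => // -[].
  by move=> x; exact: cvg_cst.
move=> x; have [Ax|nAx] := pselect (A x).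
  apply: (continuous_at_near cA.1 Ax) (@cts_fun _ _ f x) => y /set_mem Ay.
  by rewrite /cutoff_fun asboolT.
apply: (@continuous_at_near _ _ _ (fun=> 0) (~` A)) => //.
- by apply: closed_openC; exact: cA.2.
- by move=> y /set_mem nAy; rewrite /cutoff_fun asboolF// => -[].
- exact: cvg_cst.
Qed.

Definition cutoff A (f : CX) : CX := mkcts (@cutoff_fun_continuous A f).

Lemma cutoff_linear A : linear (cutoff A).
Proof.
move=> a f g; apply/continuousEP => x; rewrite /= /mkcts.
rewrite [RHS](_ : _ = a * cutoff_fun A f x + cutoff_fun A g x)// /cutoff_fun.
by case: ifP => // _; rewrite mulr0 addr0.
Qed.
HB.instance Definition _ A :=
  GRing.isLinear.Build R CX CX _ (cutoff A) (cutoff_linear A).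

Lemma cutoffE A f x :
  cutoff A f x = if `[< clopen A /\ A x >] then (f : X -> R) x else 0.
Proof. by []. Qed.

Lemma cutoffT A f x : clopen A -> A x -> cutoff A f x = f x.
Proof. by move=> cA Ax; rewrite cutoffE asboolT. Qed.

Lemma cutoffN A f x : ~ A x -> cutoff A f x = 0.
Proof. by move=> Ax; rewrite cutoffE asboolF// => -[]. Qed.

Lemma cfunD (f g : CX) x : (f + g) x = f x + g x. Proof. by []. Qed.
Lemma cfunZ a (f : CX) x : (a *: f) x = a * f x. Proof. by []. Qed.
Lemma cfun0 x : (0 : CX) x = 0. Proof. by []. Qed.

Lemma cfun_sum I (r : seq I) (P : pred I) (F : I -> CX) x :
  (\sum_(i <- r | P i) F i) x = \sum_(i <- r | P i) F i x.
Proof.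
by elim/big_rec2: _ => [|i y1 y2 _ <-]; rewrite ?cfun0 ?cfunD.
Qed.

Lemma cutoff_set0 f : cutoff set0 f = 0.
Proof. by apply/continuousEP => x; rewrite cutoffN. Qed.

Lemma cutoff_setT f : cutoff setT f = f.
Proof. by apply/continuousEP => x; rewrite cutoffT//; exact: clopenT. Qed.

Lemma cutoff_setU A B f : clopen A -> clopen B -> A `&` B = set0 ->
  cutoff (A `|` B) f = cutoff A f + cutoff B f.
Proof.
move=> cA cB AB; apply/continuousEP => x; rewrite cfunD.
have cAB := clopenU cA cB; have [Ax|nAx] := pselect (A x).
  have nBx : ~ B x by move=> Bx; have : (A `&` B) x by []; rewrite AB.
  by rewrite (cutoffN _ nBx) addr0 !cutoffT//; left.
have [Bx|nBx] := pselect (B x).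
  by rewrite (cutoffN _ nAx) add0r !cutoffT//; right.
by rewrite !cutoffN ?addr0// => -[].
Qed.

Lemma cutoff_setI A B f : clopen A -> clopen B ->
  cutoff A (cutoff B f) = cutoff (A `&` B) f.
Proof.
move=> cA cB; apply/continuousEP => x.
have [Ax|nAx] := pselect (A x); last by rewrite !cutoffN// => -[].
rewrite cutoffT//; have [Bx|nBx] := pselect (B x);
  last by rewrite !cutoffN// => -[].
by rewrite !cutoffT//; exact: clopenI.
Qed.

Lemma one_continuous : continuous ((fun=> 1) : X -> R).
Proof. by move=> x; exact: cvg_cst. Qed.

Definition cfun1 : CX := mkcts one_continuous.

End ClopenRestriction.

Section ClopenRestrictionNorm.
Context (R : realType) (X : compactType).
Local Notation CX := (cfun_type R X).
Implicit Types (f g : CX) (t : {linear CX -> R^o}).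

Lemma cfun_norm_ub f x : `|f x| <= `|f|.
Proof. exact: supnorm_ub (cfun_ubounded f). Qed.

Lemma cfun_norm_le f M : 0 <= M -> (forall x, `|f x| <= M) -> `|f| <= M.
Proof. exact: supnorm_le. Qed.

Lemma norm_cutoff_le_on A f M : 0 <= M -> (forall x, A x -> `|f x| <= M) ->
  `|cutoff A f| <= M.
Proof.
move=> M0 fM; apply: cfun_norm_le => // x; rewrite cutoffE.
by case: asboolP => [[_ /fM]//|]; rewrite normr0.
Qed.

Lemma norm_cutoff_le A f : `|cutoff A f| <= `|f|.
Proof. by apply: norm_cutoff_le_on => // x _; exact: cfun_norm_ub. Qed.

Lemma norm_bounded_cutoff t A : norm_bounded t -> norm_bounded (t \o cutoff A).
Proof.
move=> bt; exists (opnorm t) => f /=.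
apply: le_trans (opnorm_ub bt _) _.
by rewrite ler_wpM2l ?opnorm_ge0// norm_cutoff_le.
Qed.

Lemma opnorm_cutoff_ub t A f : norm_bounded t ->
  `|t (cutoff A f)| <= opnorm (t \o cutoff A) * `|f|.
Proof. by move=> bt; exact: (opnorm_ub (norm_bounded_cutoff A bt)). Qed.

(** Functionals on C(X) behave like measures: test functions of norm at most 1
    supported on disjoint clopen sets add up to a function of norm at most 1,
    hence the masses of a functional on disjoint sets add up. *)
Lemma opnorm_cutoffD t A B : norm_bounded t -> clopen A -> clopen B ->
  A `&` B = set0 ->
  opnorm (t \o cutoff A) + opnorm (t \o cutoff B) <= opnorm (t \o cutoff (A `|` B)).
Proof.
move=> bt cA cB AB; apply/ler_addgt0Pr => e e0;
  have e2 : 0 < e / 2 by rewrite divr_gt0.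
have [f f1 fe] := opnorm_approx (norm_bounded_cutoff A bt) e2.
have [g g1 ge] := opnorm_approx (norm_bounded_cutoff B bt) e2.
pose h := cutoff A f + cutoff B g.
have h1 : `|h| <= 1.
  apply: cfun_norm_le => // x; rewrite cfunD.
  have [Ax|nAx] := pselect (A x).
    have nBx : ~ B x by move=> Bx; have : (A `&` B) x by []; rewrite AB.
    by rewrite (cutoffN _ nBx) addr0 cutoffT// (le_trans (cfun_norm_ub f x)).
  rewrite (cutoffN _ nAx) add0r (le_trans (cfun_norm_ub _ x))//.
  by rewrite (le_trans (norm_cutoff_le _ _)).
have := opnorm_ub (norm_bounded_cutoff (A `|` B) bt) h; rewrite /=.
rewrite cutoff_setU// !linearD/= !cutoff_setI// !setIid AB setIC AB !cutoff_set0.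
rewrite !linear0 addr0 add0r => th.
have := le_trans (ler_norm _) th.
have : opnorm (t \o cutoff (A `|` B)) * `|h| <= opnorm (t \o cutoff (A `|` B)).
  by rewrite -[leRHS]mulr1 ler_wpM2l// opnorm_ge0//; exact: norm_bounded_cutoff.
move: fe ge => /=; lra.
Qed.

End ClopenRestrictionNorm.

(** * Decomposition along a disjoint sequence of clopen sets *)

Section DisjointSequence.
Context (R : realType) (X : compactType) (B : nat -> set X).
Hypothesis clopB : forall i, clopen (B i).
Hypothesis disjB : forall i j x, B i x -> B j x -> i = j.
Local Notation CX := (cfun_type R X).

Definition remainder (N : nat) : set X :=
  [set x | forall i, (i < N)%N -> ~ B i x].

Lemma remainder0 : remainder 0 = setT.
Proof. by apply/seteqP; split => x. Qed.

Lemma remainderS N : remainder N = B N `|` remainder N.+1.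
Proof.
apply/seteqP; split => [x rx|x [Bx i iN Bix|rx i iN]].
- have [Bx|nBx] := pselect (B N x); [by left|right => i].
  by rewrite ltnS leq_eqVlt => /orP[/eqP->//|/rx].
- by move: iN; rewrite (disjB Bix Bx) ltnn.
- by apply: rx; rewrite ltnS ltnW.
Qed.

Lemma remainder_disj N : B N `&` remainder N.+1 = set0.
Proof. by apply/seteqP; split => x // -[Bx rx]; exact: (rx N (ltnSn N) Bx). Qed.

Lemma remainder_clopen N : clopen (remainder N).
Proof.
elim: N => [|N IH]; first by rewrite remainder0; exact: clopenT.
have -> : remainder N.+1 = remainder N `&` ~` B N.
  apply/seteqP; split=> [x rx|x [rx nBx] i].
    by split=> [i iN|]; apply: rx => //; exact: ltnW.
  by rewrite ltnS leq_eqVlt => /orP[/eqP->//|/rx].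
by apply: clopenI => //; exact: (clopenC set0 (clopB N)).
Qed.

Lemma cutoff_remainder (f : CX) N :
  f = \sum_(i < N) cutoff (B i) f + cutoff (remainder N) f.
Proof.
elim: N => [|N IH]; first by rewrite big_ord0 add0r remainder0 cutoff_setT.
rewrite big_ord_recr/= -addrA -cutoff_setU// ?remainder_disj -?remainderS//.
exact: remainder_clopen.
Qed.

Lemma opnorm_cutoff_sum (t : {linear CX -> R^o}) N : norm_bounded t ->
  \sum_(i < N) opnorm (t \o cutoff (B i)) + opnorm (t \o cutoff (remainder N))
    <= opnorm t.
Proof.
move=> bt; elim: N => [|N IH].
  rewrite big_ord0 add0r remainder0; apply: opnorm_le => [|f].
    exact: opnorm_ge0.
  by rewrite /= cutoff_setT; exact: opnorm_ub.
apply: le_trans IH; rewrite big_ord_recr/= -addrA lerD2l (remainderS N).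
by apply: opnorm_cutoffD => //; [exact: remainder_clopen|exact: remainder_disj].
Qed.

End DisjointSequence.

(** * Retractions of compact lines *)

(** A cluster point of the filter generated by the final segments of A lies in
    every closed final segment. Stated for a relation so as to cover both
    maxima and minima. *)
Lemma compact_total_extremum (T : topologicalType) (e : rel T) (A : set T) :
  reflexive e -> transitive e -> total e -> (forall a, closed [set x | e a x]) ->
  compact A -> A !=set0 -> exists2 m, A m & forall a, A a -> e a m.
Proof.
move=> er et eT ce cA [a0 Aa0].
pose F := filter_from A (fun a => A `&` [set x | e a x]).
have FF : ProperFilter F.
  apply: filter_from_proper; last by move=> a Aa; exists a; split => /=.
  apply: filter_from_filter; first by exists a0.
  move=> a b Aa Ab; have [ab|ba] := orP (eT a b).
    by exists b => // x [Ax bx]; split; split => //=; exact: et bx.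
  by exists a => // x [Ax bx]; split; split => //=; exact: et bx.
have [|m [Am Fm]] := cA F FF; first by exists a0 => // x [].
exists m => // a Aa; apply: (ce a) => U Um.
have [|x [ax Ux]] := Fm [set x | e a x] U _ Um; last by exists x.
by exists a => // x [].
Qed.

Section Retraction.
Context (d : Order.disp_t) (K : compactLineType d).
Implicit Types (A F : set K) (x y z : K).
Local Open Scope order_scope.

Lemma closed_max A : closed A -> A !=set0 ->
  exists2 m, A m & forall a, A a -> a <= m.
Proof.
move=> cA; apply: (@compact_total_extremum K <=%O).
- exact: le_refl.
- exact: le_trans.
- exact: le_total.
- by move=> a; rewrite -[X in closed X]set_itvE; exact: rray_closed.
- exact: subclosed_compact cA compact_setT _.
Qed.

Lemma closed_min A : closed A -> A !=set0 ->
  exists2 m, A m & forall a, A a -> m <= a.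
Proof.
move=> cA; apply: (@compact_total_extremum K >=%O).
- exact: le_refl.
- by move=> y x z xy yz; exact: le_trans yz xy.
- by move=> x y; exact: le_total.
- by move=> a; rewrite -[X in closed X]set_itvE; exact: lray_closed.
- exact: subclosed_compact cA compact_setT _.
Qed.

(** A gap ]a, b[ of F can be cut by a clopen set. If it contains a point c, a
    clopen neighbourhood U of c avoids F, and one goes up from c for as long as
    one stays in U. The initial segment so obtained is open because U is, and
    its complement is open because a first point outside U, if any, has a
    neighbourhood outside U. *)
Lemma clopen_cut (F : set K) a b :
  (forall x, ~ F x -> exists U, [/\ clopen U, U x & U `&` F = set0]) ->
  F a -> F b -> a < b -> (forall x, F x -> x <= a \/ b <= x) ->
  exists D, [/\ clopen D, D a & ~ D b].
Proof.
move=> Fc Fa Fb ab gapab.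
have [[c /andP[ac cb]]|nc] := pselect (exists c, a < c < b); last first.
  exists `]-oo, b[%classic; split.
  - split; first exact: lray_open.
    have -> : `]-oo, b[%classic = `]-oo, a]%classic.
      rewrite !set_itvE; apply/seteqP; split => x /=; last first.
        by move=> xa; exact: le_lt_trans ab.
      by move=> xb; rewrite leNgt; apply/negP => ax; apply: nc; exists x;
        rewrite ax.
    exact: lray_closed.
  - by rewrite set_itvE.
  - by rewrite set_itvE /= ltxx.
have nFc : ~ F c.
  by move=> /gapab[ca|bc]; [rewrite leNgt ac in ca|rewrite leNgt cb in bc].
have [U [[oU cU] Uc UF]] := Fc c nFc.
exists [set y | forall z, c <= z -> z <= y -> U z]; split.
- split.
  + rewrite openE => y Dy; have [yc|cy] := ltP y c.
      apply: (@filterS _ _ _ `]-oo, c[%classic).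
        move=> w; rewrite set_itvE /= => wc z cz zw.
        by have := le_lt_trans (le_trans cz zw) wc; rewrite ltxx.
      by apply: open_nbhs_nbhs; split; [exact: lray_open|rewrite set_itvE].
    have : nbhs y U by apply: open_nbhs_nbhs; split => //; exact: Dy.
    rewrite itv_nbhsE => -[i [oi yi] iU]; rewrite /interior itv_nbhsE.
    exists i => // w wi z cz zw; have [zy|yz] := leP z y; first exact: Dy.
    apply: iU; move: wi yi => /=; case: (i) => p q /= /andP[pw wq] /andP[py yq].
    apply/andP; split.
      by apply: le_trans py _; rewrite bnd_simp ltW.
    by apply: le_trans _ wq; rewrite bnd_simp.
  + rewrite -openC openE => y nDy.
    have [z [cz zy nUz]] : exists z, [/\ c <= z, z <= y & ~ U z].
      apply: contrapT => h; apply: nDy => z cz zy; apply: contrapT => nUz.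
      by apply: h; exists z.
    have [zy'|yz] := ltP z y.
      apply: (@filterS _ _ _ `]z, +oo[%classic).
        by move=> w; rewrite set_itvE /= => zw h; apply: nUz; apply: h => //;
          exact: ltW.
      by apply: open_nbhs_nbhs; split; [exact: rray_open|rewrite set_itvE].
    have zyE : z = y by apply/eqP; rewrite eq_le zy yz.
    have cy : c < y.
      rewrite -zyE lt_neqAle cz andbT; apply/eqP => czE.
      by apply: nUz; rewrite -czE.
    apply: (@filterS _ _ _ (`]c, +oo[%classic `&` ~` U)).
      move=> w; rewrite set_itvE /= => -[cw nUw] h.
      by apply: nUw; apply: h => //; exact: ltW.
    apply: filterI; apply: open_nbhs_nbhs; split.
    * exact: rray_open.
    * by rewrite set_itvE.
    * exact: closed_openC.
    * by rewrite -zyE.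
- by move=> z cz za; have := lt_le_trans ac (le_trans cz za); rewrite ltxx.
- move=> /(_ b (ltW cb) (lexx b)) Ub.
  by have : (U `&` F) b by []; rewrite UF.
Qed.

(** Let each gap of F be cut by a clopen set D (a, b) as above, and send the
    lower half of the gap to a and the upper half to b; before the first or
    after the last point of F there is only one choice. The result is locally
    constant off F because the nearest points of F are, and D is clopen. It is
    continuous at z in F because r never crosses a point of F, so that points
    of F close to z control it, and on a side where z is isolated from F the
    cut makes r constantly equal to z near z. *)
Theorem compact_line_retraction (F : set K) : closed F -> F !=set0 ->
  (forall x, ~ F x -> exists U, [/\ clopen U, U x & U `&` F = set0]) ->
  exists r : K -> K, [/\ continuous r, forall x, F (r x),
    forall x, F x -> r x = x &
    forall x, ~ F x -> exists U, [/\ open U, U x & forall y, U y -> r y = r x]].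
Proof.
move=> cF [f0 Ff0] Fc.
have /choice[mx mxP] : forall A, exists m, closed A -> A !=set0 ->
    A m /\ forall a, A a -> a <= m.
  move=> A; have [[cA An]|h] := pselect (closed A /\ A !=set0).
    by have [m Am mA] := closed_max cA An; exists m.
  by exists f0 => cA An; case: h.
have /choice[mn mnP] : forall A, exists m, closed A -> A !=set0 ->
    A m /\ forall a, A a -> m <= a.
  move=> A; have [[cA An]|h] := pselect (closed A /\ A !=set0).
    by have [m Am mA] := closed_min cA An; exists m.
  by exists f0 => cA An; case: h.
(* The cut is chosen as a function of the endpoints of the gap alone, so that
   all points of one gap use the same one. *)
have /choice[D DP] : forall ab : K * K, exists D : set K,
    F ab.1 -> F ab.2 -> ab.1 < ab.2 ->
    (forall x, F x -> x <= ab.1 \/ ab.2 <= x) ->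
    [/\ clopen D, D ab.1 & ~ D ab.2].
  move=> [a b] /=.
  have [[Fa Fb ab g]|h] :=
    pselect ([/\ F a, F b, a < b & forall x, F x -> x <= a \/ b <= x]).
    by have [D DP] := clopen_cut Fc Fa Fb ab g; exists D.
  by exists set0 => Fa Fb ab g; case: h.
pose lo x := F `&` [set y | y <= x]; pose hi x := F `&` [set y | x <= y].
have clo x : closed (lo x).
  by apply: closedI => //; rewrite -[X in closed X]set_itvE; exact: lray_closed.
have chi x : closed (hi x).
  by apply: closedI => //; rewrite -[X in closed X]set_itvE; exact: rray_closed.
have lohi x : hi x = set0 -> lo x !=set0.
  move=> hx; exists f0; split => //=; rewrite leNgt; apply/negP => xf.
  have : hi x f0 by split => //=; exact: ltW.
  by rewrite hx.
have loP x : lo x !=set0 -> lo x (mx (lo x)) /\ forall y, lo x y -> y <= mx (lo x).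
  by move=> lx; exact: (mxP _ (clo x) lx).
have hiP x : hi x !=set0 -> hi x (mn (hi x)) /\ forall y, hi x y -> mn (hi x) <= y.
  by move=> lx; exact: (mnP _ (chi x) lx).
pose r x := if `[< hi x = set0 >] then mx (lo x)
  else if `[< lo x = set0 >] then mn (hi x)
  else if `[< D (mx (lo x), mn (hi x)) x >] then mx (lo x) else mn (hi x).
have rcase x : (lo x !=set0 /\ r x = mx (lo x)) \/ (hi x !=set0 /\ r x = mn (hi x)).
  rewrite /r; case: asboolP => [/lohi|/eqP/set0P hx]; first by left.
  case: asboolP => [_|/eqP/set0P lx]; first by right.
  by case: asboolP => _; [left|right].
have Fr x : F (r x).
  by have [[/loP[[+ _] _] ->]|[/hiP[[+ _] _] ->]] := rcase x.
have rle x z : F z -> x <= z -> r x <= z.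
  move=> Fz xz; have [[/loP[[_ /= h] _] ->]|[/hiP[_ h] ->]] := rcase x.
    exact: le_trans xz.
  exact: h.
have rge x z : F z -> z <= x -> z <= r x.
  move=> Fz xz; have [[/loP[_ h] ->]|[/hiP[[_ /= h] _] ->]] := rcase x.
    exact: h.
  exact: le_trans h.
have rid x : F x -> r x = x.
  by move=> Fx; apply/eqP; rewrite eq_le rle// rge.
have gapP x : ~ F x -> lo x !=set0 -> hi x !=set0 ->
    [/\ clopen (D (mx (lo x), mn (hi x))), D (mx (lo x), mn (hi x)) (mx (lo x)) &
        ~ D (mx (lo x), mn (hi x)) (mn (hi x))].
  move=> nFx /loP[[Fa /= ax] amax] /hiP[[Fb /= xb] bmin].
  apply: DP => //=.
    rewrite lt_neqAle (le_trans ax xb) andbT; apply/eqP => abE.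
    by apply: nFx; rewrite (_ : x = mx (lo x))//; apply/eqP;
      rewrite eq_le ax {1}abE xb.
  move=> y Fy; have [yx|xy] := leP y x; first by left; exact: amax.
  by right; apply: bmin; split => //=; exact: ltW.
have rloc x : ~ F x -> exists U, [/\ open U, U x & forall y, U y -> r y = r x].
  move=> nFx.
  pose W := (if `[< lo x = set0 >] then setT else `]mx (lo x), +oo[%classic) `&`
            (if `[< hi x = set0 >] then setT else `]-oo, mn (hi x)[%classic).
  have oW : open W.
    apply: openI; case: asboolP => _; try exact: openT.
      exact: rray_open.
    exact: lray_open.
  have Wx : W x.
    split; case: asboolP => // /eqP/set0P h; rewrite set_itvE /=.
      have [[Fa /= ax] _] := loP _ h; rewrite lt_neqAle ax andbT.
      by apply/eqP => E; apply: nFx; rewrite -E.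
    have [[Fa /= ax] _] := hiP _ h; rewrite lt_neqAle ax andbT.
    by apply/eqP => E; apply: nFx; rewrite E.
  (* W is the gap of x: its points have the same elements of F below and above
     them as x, hence the same lo and hi. *)
  have Wlo y z : W y -> F z -> (z <= y) = (z <= x).
    move=> [W1 W2] Fz; apply/idP/idP => h.
      rewrite leNgt; apply/negP => xz; move: W2.
      have hz : hi x z by split => //=; exact: ltW.
      rewrite asboolF; last by move=> h0; rewrite h0 in hz.
      rewrite set_itvE /= => yb; have [_ bmin] := hiP x (ex_intro _ z hz).
      by have := lt_le_trans (le_lt_trans h yb) (bmin _ hz); rewrite ltxx.
    move: W1; have lz : lo x z by [].
    rewrite asboolF; last by move=> h0; rewrite h0 in lz.
    rewrite set_itvE /= => ya; have [_ amax] := loP x (ex_intro _ z lz).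
    by apply: ltW; apply: le_lt_trans ya; exact: amax.
  have Whi y z : W y -> F z -> (y <= z) = (x <= z).
    move=> [W1 W2] Fz; apply/idP/idP => h.
      rewrite leNgt; apply/negP => zx; move: W1.
      have hz : lo x z by split => //=; exact: ltW.
      rewrite asboolF; last by move=> h0; rewrite h0 in hz.
      rewrite set_itvE /= => yb; have [_ bmin] := loP x (ex_intro _ z hz).
      by have := le_lt_trans (bmin _ hz) (lt_le_trans yb h); rewrite ltxx.
    move: W2; have lz : hi x z by [].
    rewrite asboolF; last by move=> h0; rewrite h0 in lz.
    rewrite set_itvE /= => ya; have [_ amax] := hiP x (ex_intro _ z lz).
    by apply: ltW; apply: lt_le_trans ya _; exact: amax.
  have loE y : W y -> lo y = lo x.
    by move=> Wy; apply/seteqP; split => z [Fz /= h]; split => //=; move: h;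
      rewrite Wlo.
  have hiE y : W y -> hi y = hi x.
    by move=> Wy; apply/seteqP; split => z [Fz /= h]; split => //=; move: h;
      rewrite Whi.
  have [hx|/set0P hx] := eqVneq (hi x) set0.
    by exists W; split => // y Wy; rewrite /r loE// hiE// hx asboolT.
  have [lx|/set0P lx] := eqVneq (lo x) set0.
    exists W; split => // y Wy; rewrite /r loE// hiE// lx.
    by rewrite (asboolT (erefl (set0 : set K))).
  have [[oD cD] _ _] := gapP x nFx lx hx.
  set D0 := D _ in oD cD.
  have [Dx|nDx] := pselect (D0 x).
    exists (W `&` D0); split => //; first exact: openI.
    by move=> y [Wy Dy];
      rewrite /r loE// hiE// -/D0 !(asboolT Dx) !(asboolT Dy).
  exists (W `&` ~` D0); split => //; first by apply: openI => //;
    exact: closed_openC.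
  by move=> y [Wy Dy]; rewrite /r loE// hiE// -/D0 !(asboolF nDx) !(asboolF Dy).
(* One-sided continuity at z: either F meets ]z, t[ and r stays below that
   point of F, or the gap on the right of z is cut. *)
have rright z t : F z -> z < t -> exists W, nbhs z W /\ forall x, W x -> r x < t.
  move=> Fz zt.
  have nray u : z < u -> nbhs z `]-oo, u[%classic.
    by move=> zu; apply: open_nbhs_nbhs; split;
      [exact: lray_open|rewrite set_itvE].
  have [[z' [Fz' /andP[zz' z't]]]|nz'] :=
    pselect (exists z', F z' /\ z < z' < t).
    exists `]-oo, z'[%classic; split; first exact: nray.
    by move=> x; rewrite set_itvE /= => /ltW xz';
      exact: le_lt_trans (rle _ _ Fz' xz') z't.
  pose G := F `&` [set y | t <= y].
  have hiG x : z < x -> x < t -> hi x = G.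
    move=> zx xt; apply/seteqP; split => y [Fy /= h]; split => //=; last first.
      exact: le_trans (ltW xt) h.
    rewrite leNgt; apply/negP => yt; apply: nz'; exists y; split => //.
    by rewrite yt (lt_le_trans zx h).
  have loz x : z < x -> x < t -> mx (lo x) = z.
    move=> zx xt; have lz : lo x z by split => //=; exact: ltW.
    have [[Fm /= mxx] mmax] := loP x (ex_intro _ z lz).
    apply/eqP; rewrite eq_le mmax// andbT leNgt; apply/negP => zm.
    by apply: nz'; exists (mx (lo x)); split => //;
      rewrite zm (le_lt_trans mxx).
  have cG : closed G.
    by apply: closedI => //; rewrite -[X in closed X]set_itvE;
      exact: rray_closed.
  pose W := if `[< G = set0 >] then setT else D (z, mn G).
  have nW : nbhs z W.
    rewrite /W; case: asboolP => [_|/eqP/set0P Gn]; first exact: filterT.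
    have [[Fb /= tb] bmin] := mnP G cG Gn.
    have [||||[oD _] Dz _] := DP (z, mn G) => //=.
    - exact: lt_le_trans tb.
    - move=> y Fy; have [yz|zy] := leP y z; [by left|right; apply: bmin].
      split => //=; rewrite leNgt; apply/negP => yt.
      by apply: nz'; exists y; rewrite zy.
    - by apply: open_nbhs_nbhs.
  exists (`]-oo, t[%classic `&` W); split; first by apply: filterI => //;
    exact: nray.
  move=> x; rewrite set_itvE => -[/= xt Wx].
  have [xz|zx] := leP x z; first exact: le_lt_trans (rle _ _ Fz xz) zt.
  suff -> : r x = z by [].
  move: Wx; rewrite /r /W hiG// loz//; case: asboolP => // _.
  rewrite asboolF; first by move=> Dx; rewrite asboolT.
  move=> l0; have : lo x z by split => //=; exact: ltW.
  by rewrite l0.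
(* The mirror image of the previous argument. *)
have rleft z t : F z -> t < z -> exists W, nbhs z W /\ forall x, W x -> t < r x.
  move=> Fz tz.
  have nray u : u < z -> nbhs z `]u, +oo[%classic.
    by move=> zu; apply: open_nbhs_nbhs; split;
      [exact: rray_open|rewrite set_itvE].
  have [[z' [Fz' /andP[tz' z'z]]]|nz'] :=
    pselect (exists z', F z' /\ t < z' < z).
    exists `]z', +oo[%classic; split; first exact: nray.
    by move=> x; rewrite set_itvE /= => /ltW xz';
      exact: lt_le_trans tz' (rge _ _ Fz' xz').
  pose G := F `&` [set y | y <= t].
  have loG x : x < z -> t < x -> lo x = G.
    move=> xz tx; apply/seteqP; split => y [Fy /= h]; split => //=; last first.
      exact: le_trans h (ltW tx).
    rewrite leNgt; apply/negP => yt; apply: nz'; exists y; split => //.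
    by rewrite yt (le_lt_trans h xz).
  have hiz x : x < z -> t < x -> mn (hi x) = z.
    move=> xz tx; have lz : hi x z by split => //=; exact: ltW.
    have [[Fm /= mxx] mmin] := hiP x (ex_intro _ z lz).
    apply/eqP; rewrite eq_le mmin//= leNgt; apply/negP => mz.
    by apply: nz'; exists (mn (hi x)); split => //; rewrite mz (lt_le_trans tx).
  have cG : closed G.
    by apply: closedI => //; rewrite -[X in closed X]set_itvE;
      exact: lray_closed.
  pose W := if `[< G = set0 >] then setT else ~` D (mx G, z).
  have nW : nbhs z W.
    rewrite /W; case: asboolP => [_|/eqP/set0P Gn]; first exact: filterT.
    have [[Fb /= bt] bmax] := mxP G cG Gn.
    have [||||[_ cD] _ nDz] := DP (mx G, z) => //=.
    - exact: le_lt_trans tz.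
    - move=> y Fy; have [zy|yz] := leP z y; [by right|left; apply: bmax].
      split => //=; rewrite leNgt; apply/negP => ty.
      by apply: nz'; exists y; rewrite yz andbT.
    - by apply: open_nbhs_nbhs; split => //; exact: closed_openC.
  exists (`]t, +oo[%classic `&` W); split; first by apply: filterI => //;
    exact: nray.
  move=> x; rewrite set_itvE => -[/= xt Wx].
  have [xz|zx] := leP z x; first exact: lt_le_trans tz (rge _ _ Fz xz).
  suff -> : r x = z by [].
  move: Wx; rewrite /r /W loG// hiz//.
  rewrite (@asboolF (hi x = set0)); last first.
    move=> l0; have : hi x z by split => //=; exact: ltW.
    by rewrite l0.
  by case: asboolP => // _ nDx; rewrite asboolF.
exists r; split => // x.
have [Fx|nFx] := pselect (F x); last first.
  have [U [oU Ux rU]] := rloc x nFx.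
  apply: (@continuous_at_near _ _ _ (fun=> r x) _ _ oU Ux).
    by move=> y /set_mem; exact: rU.
  exact: cvg_cst.
move=> V /=; rewrite rid// => nV; have := nV;
  rewrite {1}itv_nbhsE => -[i [oi xi] iV].
suff nri : nbhs x (r @^-1` [set` i]) by apply: filterS nri => y; exact: iV.
case: i oi xi {iV} => p q oi /= /andP[px xq].
have nq : nbhs x [set y | (BRight (r y) <= q)%O].
  case: q oi xq => [b u|b] oi xq.
    move: xq; rewrite (itv_open_ends_rside oi) bnd_simp => xu.
    have [W [nW rW]] := rright x u Fx xu.
    by apply: filterS nW => y /rW; rewrite /= bnd_simp.
  by rewrite (itv_open_ends_rinfty oi); apply: filterE => y.
have np : nbhs x [set y | (p <= BLeft (r y))%O].
  case: p oi px {nq} => [b u|b] oi px.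
    move: px; rewrite (itv_open_ends_lside oi) bnd_simp => ux.
    have [W [nW rW]] := rleft x u Fx ux.
    by apply: filterS nW => y /rW; rewrite /= bnd_simp.
  by rewrite (itv_open_ends_linfty oi); apply: filterE => y.
by apply: filterS2 np nq => y /= pr rq; apply/andP.
Qed.

End Retraction.

(** * Functionals on the range of a pullback *)

Section PullbackFunctionals.
Context (R : realType) (K L : compactType) (phi : continuousType K L).
Hypothesis surj_phi : set_surj [set: K] [set: L] phi.
Local Notation CK := (cfun_type R K).
Local Notation CL := (cfun_type R L).

Lemma pullbackE (h : CL) x : pullback R phi h x = h (phi x).
Proof. by []. Qed.

Lemma norm_pullback (h : CL) : `|pullback R phi h| = `|h|.
Proof.
apply/eqP; rewrite eq_le; apply/andP; split; apply: cfun_norm_le => // x.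
  by rewrite pullbackE; exact: cfun_norm_ub.
have [y _ <-] := surj_phi (I : [set: L] x).
by rewrite -pullbackE; exact: cfun_norm_ub.
Qed.

Lemma hahn_banach_pullback (t : {linear CL -> R^o}) : norm_bounded t ->
  exists rho : {linear CK -> R^o}, (forall h, rho (pullback R phi h) = t h) /\
    forall f, `|rho f| <= opnorm t * `|f|.
Proof.
move=> bt.
pose G0 := [set (pullback R phi h, t h : R) | h in [set: CL]].
have [|||_ [h _ <-] /=|rho [rhoE rhoM]] := @hahn_banach R CK G0 (opnorm t).
- exact: opnorm_ge0.
- by exists (pullback R phi 0, t 0), 0.
- move=> c _ _ [h _ <-] [k _ <-] /=; exists (c *: h + k) => //.
  by rewrite !linearP.
- rewrite norm_pullback; apply: le_trans (ler_norm _) _; exact: opnorm_ub.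
by exists rho; split=> // h; rewrite (rhoE (pullback R phi h, t h : R))//;
  exists h.
Qed.

(** A norm preserving extension puts no mass over a set A where t has none:
    a function supported over A can be added to a pullback from the complement
    of A that almost attains the norm of t, without raising the sup norm. *)
Lemma norm_preserving_null (t : {linear CL -> R^o}) (rho : {linear CK -> R^o}) A f :
  norm_bounded t -> (forall h, rho (pullback R phi h) = t h) ->
  (forall f, `|rho f| <= opnorm t * `|f|) ->
  clopen A -> (forall h, t (cutoff A h) = 0) ->
  rho (cutoff (phi @^-1` A) f) = 0.
Proof.
move=> bt rhoE rhoM cA tA.
suff rho_le0 g : rho (cutoff (phi @^-1` A) g) <= 0.
  apply/eqP; rewrite eq_le rho_le0 /= -oppr_le0 -linearN -linearN;
    exact: rho_le0.
apply/ler_addgt0Pr => e e0; rewrite add0r.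
have g1 : 0 < `|g| + 1 by rewrite ltr_wpDl.
have [h h1 he] := opnorm_approx bt (divr_gt0 e0 g1).
have cA' : clopen (~` A) by exact: (clopenC set0 cA).
have hE : t h = t (cutoff (~` A) h).
  rewrite -{1}[h]cutoff_setT -(setUv A) cutoff_setU ?setICr// linearD tA.
  by rewrite [LHS]add0r.
pose F := cutoff (phi @^-1` A) g + `|g| *: pullback R phi (cutoff (~` A) h).
have F1 : `|F| <= `|g|.
  apply: cfun_norm_le => // x; rewrite cfunD cfunZ pullbackE.
  have [Ax|nAx] := pselect (A (phi x)).
    rewrite (@cutoffN _ _ (~` A))// mulr0 addr0 cutoffT//;
      last exact: clopen_preimage.
    exact: cfun_norm_ub.
  rewrite cutoffN// add0r normrM normr_id -[leRHS]mulr1 ler_wpM2l//.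
  by rewrite (le_trans (cfun_norm_ub _ _))// (le_trans (norm_cutoff_le _ _)).
have rF := le_trans (ler_norm _) (rhoM F).
rewrite linearD linearZ /= rhoE -hE in rF.
have N0 := opnorm_ge0 bt.
have FN : opnorm t * `|F| <= `|g| * opnorm t by rewrite mulrC ler_wpM2r.
have th : `|g| * opnorm t - `|g| * (e / (`|g| + 1)) <= `|g| * t h.
  by rewrite -mulrBr ler_wpM2l// ltW.
have ge : `|g| * (e / (`|g| + 1)) <= e.
  rewrite mulrCA -[leRHS]mulr1 (ler_wpM2l (ltW e0))//.
  by rewrite ler_pdivrMr// mul1r lerDl.
have arith (a b c p q : R) :
    a + b <= p -> q <= e -> c - q <= b -> p <= c -> a <= e by lra.
exact: arith rF ge th FN.
Qed.

End PullbackFunctionals.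

(** Take for N n the largest N <= n such that a N n <= 1 / (N + 1). *)
Lemma slow_growth (R : realType) (a : nat -> nat -> R) :
  (forall n, a 0%N n = 0) -> (forall N, a N n @[n --> \oo] --> 0) ->
  (forall N n, 0 <= a N n) ->
  exists N : nat -> nat, (forall N0, \forall n \near \oo, (N0 <= N n)%N) /\
    a (N n) n @[n --> \oo] --> 0.
Proof.
move=> a0 acvg age0.
pose P n := [pred N | (N <= n)%N && (a N n <= N.+1%:R^-1)].
have P0 n : exists N, P n N by exists 0%N; rewrite /= a0 invr_ge0 ler0n.
have PM n N : P n N -> (N <= n)%N by case/andP.
pose N n := ex_maxn (P0 n) (PM n).
have NP n : P n (N n) by rewrite /N; case: ex_maxnP.
have Ninf N0 : \forall n \near \oo, (N0 <= N n)%N.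
  have /cvgr0Pnorm_le/(_ N0.+1%:R^-1) := acvg N0.
  rewrite invr_gt0 ltr0n => /(_ isT) h.
  near=> n; rewrite /N; case: ex_maxnP => m _; apply; apply/andP; split.
    by near: n; exact: nbhs_infty_ge.
  by rewrite -[leLHS]ger0_norm//; near: n.
exists N; split=> //; apply/cvgr0Pnorm_le => e e0.
have [N0 N0e] : exists N0 : nat, N0.+1%:R^-1 <= e.
  have := archi_boundP (ltW (_ : 0 < e^-1)); rewrite invr_gt0 => /(_ e0) h.
  exists (Num.bound e^-1); rewrite invf_ple ?posrE ?ltr0n//.
  by apply: le_trans (ltW h) _; rewrite ler_nat.
near=> n; rewrite ger0_norm//.
have /andP[_ h] := NP n; apply: le_trans h _; apply: le_trans N0e.
by rewrite lef_pV2 ?posrE ?ltr0n// ler_nat ltnS; near: n; exact: Ninf.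
Unshelve. all: by end_near. Qed.

(** * Gluing the extensions of the pieces *)

Lemma cvg_sum0 (R : realType) (u : nat -> nat -> R) N :
  (forall i, u i n @[n --> \oo] --> 0) ->
  (\sum_(i < N) u i n) @[n --> \oo] --> 0.
Proof.
move=> u0; elim: N => [|N IH].
  rewrite (_ : (fun _ => _) = cst 0); [exact: cvg_cst|].
  by apply/funext => n; rewrite big_ord0.
rewrite (_ : (fun _ => _) = (fun n => \sum_(i < N) u i n) \+ u N).
  by have h := cvgD IH (u0 N); rewrite addr0 in h; exact: h.
by apply/funext => n; rewrite big_ord_recr.
Qed.

(** The data of the gluing argument. The functionals tau n on C(L) are the
    coordinates of the operator to be extended, V i n extends the part of
    tau n that lives on B i, and delta i is the summable slack allowed there.
    P is meant to replace a function on K by one that is determined by its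
    values on the fibre of the exceptional point, and ev to evaluate at a point
    of that fibre, or both to vanish when there is no such point. *)
Section Gluing.
Context (R : realType) (K L : compactType) (phi : continuousType K L).
Hypothesis surj_phi : set_surj [set: K] [set: L] phi.
Local Notation CK := (cfun_type R K).
Local Notation CL := (cfun_type R L).

Variables (tau : nat -> {linear CL -> R^o}) (M : R).
Hypothesis M0 : 0 <= M.
Hypothesis tauM : forall n h, `|tau n h| <= M * `|h|.
Hypothesis tau0 : forall h, (tau n h : R) @[n --> \oo] --> (0 : R).

Variable B : nat -> set L.
Hypothesis clopB : forall i, clopen (B i).
Hypothesis disjB : forall i j x, B i x -> B j x -> i = j.

Variables (V : nat -> nat -> {linear CK -> R^o}) (lambda eta : R) (delta : nat -> R).
Hypothesis lambda2 : 2 <= lambda.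
Hypothesis eta0 : 0 < eta.
Hypothesis delta0 : forall i, 0 <= delta i.
Hypothesis sum_delta : forall N, \sum_(i < N) delta i <= eta.
Hypothesis V_tau : forall i n h,
  V i n (pullback R phi h) = tau n (cutoff (B i) h).
Hypothesis V_bound : forall i n f, `|V i n f| <=
  lambda * (opnorm (tau n \o cutoff (B i)) + delta i) *
    `|cutoff (phi @^-1` B i) f|.
Hypothesis V_cvg : forall i f, (V i n f : R) @[n --> \oo] --> (0 : R).

Variables (P : {linear CK -> CK}) (ev : {linear CK -> R^o}).
Hypothesis P_norm : forall f, `|P f| <= `|f|.
Hypothesis ev_norm : forall f, `|ev f| <= `|f|.
Hypothesis P_pullback : forall h,
  P (pullback R phi h) = ev (pullback R phi h) *: cfun1 R K.
Hypothesis VP_cvg : forall i, opnorm (V i n \o P) @[n --> \oo] --> (0 : R).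
Hypothesis P_small : forall (f : CK) e, 0 < e -> exists (N0 : nat) (Z : set L),
  [/\ clopen Z, forall n h, tau n (cutoff Z h) = 0,
      forall i x, Z x -> ~ B i x &
      forall x, ~ Z (phi x) -> remainder B N0 (phi x) ->
        `|f x - P f x| <= e].

Let lambda0 : 0 <= lambda.
Proof. by apply: le_trans lambda2. Qed.

Let btau n : norm_bounded (tau n).
Proof. by exists M. Qed.

Let opnorm_tau n : opnorm (tau n) <= M.
Proof. exact: opnorm_le. Qed.

Let opnorm_tauB_ge0 n A : 0 <= opnorm (tau n \o cutoff A).
Proof. exact/opnorm_ge0/norm_bounded_cutoff. Qed.

Let opnorm_tau_sum n N : \sum_(i < N) opnorm (tau n \o cutoff (B i)) +
  opnorm (tau n \o cutoff (remainder B N)) <= M.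
Proof. exact: le_trans (opnorm_cutoff_sum clopB disjB N (btau n)) _. Qed.

Let bVP i n : norm_bounded (V i n \o P).
Proof.
exists (lambda * (opnorm (tau n \o cutoff (B i)) + delta i)) => f /=.
apply: le_trans (V_bound i n _) _; rewrite ler_wpM2l//.
  by rewrite mulr_ge0// addr_ge0.
by apply: le_trans (norm_cutoff_le _ _) (P_norm f).
Qed.

(** What prevents the sum of the first N pieces at time n from being
    negligible on the range of P and on constants. *)
Let defect (N n : nat) : R :=
  \sum_(i < N) (opnorm (V i n \o P) + `|tau n (cutoff (B i) (cfun1 R L))|).

Let defect_ge0 N n : 0 <= defect N n.
Proof.
by apply: sumr_ge0 => i _; rewrite addr_ge0//; exact: opnorm_ge0.
Qed.

Let defect_cvg N : defect N n @[n --> \oo] --> 0.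
Proof.
apply: (@cvg_sum0 R (fun i n =>
  opnorm (V i n \o P) + `|tau n (cutoff (B i) (cfun1 R L))|)) => i.
have h := cvgD (VP_cvg i) (cvg_norm (tau0 (cutoff (B i) (cfun1 R L)))).
by rewrite normr0 addr0 in h; exact: h.
Qed.

(** At time n the first N n pieces are handled by the functionals V i n. The
    rest t n of tau n is extended without increasing its norm and applied to
    f - P f, which costs a factor 2 <= lambda but makes it converge to 0, as
    f - P f is small away from finitely many pieces; the term c n * ev f
    repairs the values on pullbacks. Since N n goes to infinity slowly, the
    defect tends to 0, hence so do c n and the first part on P f. For the
    finitely many n at which c n is still large, a norm preserving extension
    of tau n is used instead. *)
Lemma glue_extensions : exists T' : nat -> {linear CK -> R^o},
  [/\ forall n h, T' n (pullback R phi h) = tau n h,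
      forall n f, `|T' n f| <= (lambda * (M + eta) + eta) * `|f| &
      forall f, (T' n f : R) @[n --> \oo] --> (0 : R)].
Proof.
have [|N [Ninf Ncvg]] := slow_growth _ defect_cvg defect_ge0.
  by move=> n; rewrite /defect big_ord0.
pose t n : {linear CL -> R^o} := tau n \o cutoff (remainder B (N n)).
have bt n : norm_bounded (t n) by exact: norm_bounded_cutoff.
have /choice[rho rhoP] := fun n => hahn_banach_pullback surj_phi (bt n).
pose c n : R := t n (cfun1 R L).
pose S n f : R := \sum_(i < N n) (V i n f : R) + (rho n (f - P f) : R) + c n * ev f.
have linS n : scalar (S n).
  move=> a f g; rewrite /S; under eq_bigr do rewrite linearP.
  rewrite big_split/= -scaler_sumr.
  rewrite [P _]linearP opprD addrACA -scalerBr linearP linearP.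
  have arith (s s' u u' v e e' : R) : a * s + s' + (a * u + u') + v * (a * e + e')
      = a * (s + u + v * e) + (s' + u' + v * e') by ring.
  exact: arith.
pose T n := functional (linS n).
have c_le n : `|c n| <= `|tau n (cfun1 R L)| + defect (N n) n.
  have := congr1 (tau n) (cutoff_remainder clopB disjB (cfun1 R L) (N n)).
  rewrite linearD linear_sum => h.
  have -> : c n = tau n (cfun1 R L) - \sum_(i < N n) tau n (cutoff (B i) (cfun1 R L)).
    by rewrite h addrC addKr.
  apply: le_trans (ler_normB _ _) _; rewrite lerD2l.
  apply: le_trans (ler_norm_sum _ _ _) _; apply: ler_sum => i _.
  by rewrite lerDr opnorm_ge0.
have c_cvg : c n @[n --> \oo] --> 0.
  apply/norm_cvg0P; apply: squeeze_cvgr; last first.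
  - have h := cvgD (cvg_norm (tau0 (cfun1 R L))) Ncvg.
    by rewrite normr0 addr0 in h; exact: h.
  - exact: cvg_cst.
  - by apply: nearW => n; rewrite normr_ge0 c_le.
have T_pull n h : T n (pullback R phi h) = tau n h.
  rewrite [LHS]/(S n _) /S P_pullback.
  have -> : cfun1 R K = pullback R phi (cfun1 R L) by apply/continuousEP.
  have [rhoE _] := rhoP n.
  set e := ev _.
  have -> : pullback R phi h - e *: pullback R phi (cfun1 R L) =
      pullback R phi (h - e *: cfun1 R L) by apply/continuousEP.
  rewrite rhoE linearB linearZ; under eq_bigr do rewrite V_tau.
  have := congr1 (tau n) (cutoff_remainder clopB disjB h (N n)).
  rewrite linearD linear_sum => ->.
  have arith (s u v : R) : s + (u - e * v) + v * e = s + u by ring.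
  exact: arith.
have T_bound n f : `|T n f| <= (lambda * (M + eta) + `|c n|) * `|f|.
  rewrite [T n f]/(S n f) /S; apply: le_trans (ler_normD _ _) _.
  rewrite mulrDl; apply: lerD; last by rewrite normrM ler_wpM2l.
  apply: le_trans (ler_normD _ _) _.
  have h1 : `|\sum_(i < N n) (V i n f : R)| <= lambda *
      (\sum_(i < N n) opnorm (tau n \o cutoff (B i)) + eta) * `|f|.
    apply: le_trans (ler_norm_sum _ _ _) _.
    apply: (@le_trans _ _ (\sum_(i < N n)
        lambda * (opnorm (tau n \o cutoff (B i)) + delta i) * `|f|)).
      apply: ler_sum => i _; apply: le_trans (V_bound i n f) _.
      by rewrite ler_wpM2l ?norm_cutoff_le// mulr_ge0// addr_ge0.
    rewrite -mulr_suml -mulr_sumr big_split/= ler_wpM2r// ler_wpM2l//.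
    by rewrite lerD2l; exact: sum_delta.
  have h2 : `|rho n (f - P f) : R| <= lambda * opnorm (t n) * `|f|.
    have [_ rhoM] := rhoP n; apply: le_trans (rhoM _) _.
    apply: (@le_trans _ _ (opnorm (t n) * (2 * `|f|))).
      apply: ler_wpM2l; first exact: opnorm_tauB_ge0.
      rewrite mulr_natl mulr2n.
      by apply: le_trans (ler_normB _ _) _; rewrite lerD2l.
    rewrite mulrA ler_wpM2r// mulrC ler_wpM2r//; exact: opnorm_tauB_ge0.
  apply: le_trans (lerD h1 h2) _;
    rewrite -mulrDl ler_wpM2r// -mulrDr ler_wpM2l//.
  by rewrite addrAC lerD2r; exact: opnorm_tau_sum.
have T_cvg f : (T n f : R) @[n --> \oo] --> (0 : R).
  apply/cvgr0Pnorm_le => e e0.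
  pose C := lambda * (M + eta) + M.
  have C0 : 0 <= C by rewrite addr_ge0// mulr_ge0// addr_ge0// ltW.
  have e'0 : 0 < e / 4 / (C + 1) by rewrite !divr_gt0// ltr_wpDl.
  set e' := e / 4 / (C + 1) in e'0.
  have [N0 [Z [cZ tauZ BZ fZ]]] := P_small f e'0.
  pose f0 := f - P f.
  have f0_small x : ~ Z (phi x) -> remainder B N0 (phi x) -> `|f0 x| <= e' by exact: fZ.
  have e4 : 0 < e / 4 by rewrite divr_gt0.
  have head_cvg : (\sum_(i < N0) `|V i n f0 : R|) @[n --> \oo] --> 0.
    apply: (@cvg_sum0 R (fun i n => `|V i n f0 : R|)) => i.
    by have h := cvg_norm (V_cvg i f0); rewrite normr0 in h; exact: h.
  have defect_f : (defect (N n) n * `|f|) @[n --> \oo] --> 0.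
    by have h := cvgMr_tmp (b := `|f|) Ncvg; rewrite mul0r in h; exact: h.
  have c_f : (c n * `|f|) @[n --> \oo] --> 0.
    by have h := cvgMr_tmp (b := `|f|) c_cvg; rewrite mul0r in h; exact: h.
  have /cvgr0Pnorm_le/(_ _ e4) H1 := head_cvg.
  have /cvgr0Pnorm_le/(_ _ e4) H2 := defect_f.
  have /cvgr0Pnorm_le/(_ _ e4) H3 := c_f.
  near=> n.
  have NN0 : (N0 <= N n)%N by near: n; exact: Ninf.
  have A1 : \sum_(i < N0) `|V i n f0 : R| <= e / 4.
    by apply: le_trans (ler_norm _) _; near: n.
  have A2 : defect (N n) n * `|f| <= e / 4.
    by apply: le_trans (ler_norm _) _; near: n.
  have A3 : `|c n| * `|f| <= e / 4.
    by rewrite -[X in _ * X]normr_id -normrM; near: n.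
  (* The first part on P f, the pieces before N0 on f0 and the constant term
     contribute e / 4 each; all the rest is at most C * e' <= e / 4. *)
  have A4 : `|\sum_(i < N n) (V i n (P f) : R)| <= defect (N n) n * `|f|.
    apply: le_trans (ler_norm_sum _ _ _) _; rewrite mulr_suml;
      apply: ler_sum => i _.
    apply: le_trans (opnorm_ub (bVP i n) f) _; rewrite ler_wpM2r// lerDl//.
  (* The pieces before N0 tend to 0 one by one; over the others f0 is at most
     e', and their total mass is bounded. *)
  have A5 : `|\sum_(i < N n) (V i n f0 : R)| <= e / 4 + lambda * (M + eta) * e'.
    apply: le_trans (ler_norm_sum _ _ _) _.
    apply: (@le_trans _ _ (\sum_(i < N n) ((if (i < N0)%N then `|V i n f0 : R| else 0)
        + lambda * (opnorm (tau n \o cutoff (B i)) + delta i) * e'))).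
      apply: ler_sum => i _.
      have ge0 : 0 <= lambda * (opnorm (tau n \o cutoff (B i)) + delta i).
        by rewrite mulr_ge0// addr_ge0.
      case: ltnP => iN0; first by rewrite lerDl mulr_ge0// ltW.
      rewrite add0r; apply: le_trans (V_bound i n f0) _; rewrite ler_wpM2l//.
      apply: norm_cutoff_le_on => [|x Bx]; first exact: ltW.
      apply: f0_small => [/BZ/(_ Bx)//|j jN0 Bj].
      by move: iN0; rewrite (disjB Bx Bj) leqNgt jN0.
    rewrite big_split/= -big_mkcond/= -(big_ord_widen (N n) (fun i => `|V i n f0 : R|) NN0).
    apply: lerD => //; rewrite -mulr_suml -mulr_sumr ler_wpM2r ?(ltW e'0)//.
    rewrite ler_wpM2l// big_split/=; apply: lerD; last exact: sum_delta.
    by apply: le_trans (opnorm_tau_sum n (N n)); rewrite lerDl;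
      exact: opnorm_tauB_ge0.
  have A6 : `|rho n f0 : R| <= M * e'.
  (* Over Z' the function f0 may be large, but there t n has no mass. *)
    pose Z' := Z `|` ~` remainder B N0.
    have cZ' : clopen Z'.
      by apply: clopenU => //;
        exact: (clopenC set0 (remainder_clopen clopB N0)).
    have cr := remainder_clopen clopB (N n).
    have ZrE : remainder B (N n) `&` Z' = Z `&` remainder B (N n).
      apply/seteqP; split=> x [rx Zx]; last by split => //; left.
      split=> //; case: Zx => // nr; exfalso; apply: nr => j jN0; apply: rx.
      exact: leq_trans NN0.
    have tZ' h : t n (cutoff Z' h) = 0.
      by rewrite /t /= cutoff_setI// ZrE -cutoff_setI.
    have [rhoE rhoM] := rhoP n.
    have cpZ' := @clopen_preimage _ _ phi _ cZ'.
    have cpZ'C : clopen (~` (phi @^-1` Z')) by exact: (clopenC set0 cpZ').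
    have f0E : f0 = cutoff (phi @^-1` Z') f0 + cutoff (~` (phi @^-1` Z')) f0.
      by rewrite -cutoff_setU ?setICr// setUv cutoff_setT.
    rewrite f0E linearD (norm_preserving_null _ (bt n) rhoE rhoM cZ' tZ').
    rewrite [0 + _]add0r; apply: le_trans (rhoM _) _.
    apply: ler_pM => //; first exact: opnorm_tauB_ge0.
      apply: le_trans (opnorm_tau_sum n (N n)); rewrite lerDr.
      by apply: sumr_ge0 => i _; exact: opnorm_tauB_ge0.
    apply: norm_cutoff_le_on => [|x nZx]; first exact: ltW.
    apply: f0_small => [Zx|]; first by apply: nZx; left.
    by apply: contrapT => nr; apply: nZx; right.
  have A7 : C * e' <= e / 4.
    rewrite /e' mulrA ler_pdivrMr ?ltr_wpDl// mulrC ler_wpM2l ?ltW//.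
    by rewrite ltrDl.
  have A8 : `|c n * ev f| <= e / 4.
    by rewrite normrM; apply: le_trans A3; rewrite ler_wpM2l.
  have SE : T n f = \sum_(i < N n) (V i n (P f) : R) +
      \sum_(i < N n) (V i n f0 : R) + rho n f0 + c n * ev f :> R.
    rewrite [T n f]/(S n f) /S -big_split/=; congr (_ + _ + _).
    by apply: eq_bigr => i _; rewrite -linearD /f0 addrC subrK.
  rewrite SE.
  apply: le_trans (ler_normD _ _) _.
  have := ler_normD (\sum_(i < N n) (V i n (P f) : R) +
      \sum_(i < N n) (V i n f0 : R)) (rho n f0).
  have := ler_normD (\sum_(i < N n) (V i n (P f) : R))
      (\sum_(i < N n) (V i n f0 : R)).
  move: A2 A4 A5 A6 A7 A8; rewrite /C mulrDl; lra.
have /cvgr0Pnorm_le/(_ eta eta0) [n0 _ n0P] := c_cvg.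
have /choice[sigma sigmaP] := fun n => hahn_banach_pullback surj_phi (btau n).
exists (fun n => if (n < n0)%N then sigma n else T n); split.
- by move=> n h; case: ifP => _; [have [+ _] := sigmaP n; exact|exact: T_pull].
- move=> n f; case: ltnP => nn0; last first.
    by apply: le_trans (T_bound n f) _; rewrite ler_wpM2r// lerD2l n0P.
  have [_ h] := sigmaP n; apply: le_trans (h f) _; rewrite ler_wpM2r//.
  apply: le_trans (opnorm_tau n) _.
  have : 1 * M <= lambda * (M + eta).
    apply: ler_pM => //; first by apply: le_trans lambda2; rewrite ler1n.
    by rewrite lerDl ltW.
  by rewrite mul1r => /le_trans; apply; rewrite lerDl ltW.
- move=> f; apply: cvg_trans (T_cvg f); apply: near_eq_cvg.
  by exists n0 => // n /= n0n; rewrite ltnNge n0n.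
Unshelve. all: by end_near. Qed.

End Gluing.

(** * Operators into the null sequences *)

Section NullSequenceOperators.
Context (R : realType) (X : normedModType R).

Lemma c0_operator (t : nat -> {linear X -> R^o}) :
  (forall x, (t n x : R) @[n --> \oo] --> (0 : R)) ->
  exists T : {linear X -> c0 R}, forall x n, val (T x) n = t n x.
Proof.
move=> t0.
pose F x : c0 R := exist _ (fun n => t n x : R) (introT (asboolP _) (t0 x)).
have linF : linear F.
  by move=> a x y; apply: val_inj; apply/funext => n; exact: (linearP (t n)).
by pose T : {linear X -> c0 R} :=
  HB.pack F (GRing.isLinear.Build R X (c0 R) *:%R F linF); exists T.
Qed.

Variable T : {linear X -> c0 R}.

Definition coordinate_fun n (x : X) : R := val (T x) n.

Lemma coordinate_scalar n : scalar (coordinate_fun n).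
Proof. by move=> a x y; rewrite /coordinate_fun linearP. Qed.

Definition coordinate n := functional (coordinate_scalar n).

Lemma coordinateE n x : coordinate n x = val (T x) n. Proof. by []. Qed.

Lemma coordinate_le n x : `|coordinate n x : R| <= `|T x|.
Proof. by rewrite coordinateE; exact/supnorm_ub/c0_ubounded. Qed.

Lemma coordinate_cvg x : (coordinate n x : R) @[n --> \oo] --> (0 : R).
Proof. by have /asboolP := valP (T x). Qed.

Lemma c0_operator_le M : 0 <= M ->
  (forall n x, `|val (T x) n| <= M * `|x|) -> forall x, `|T x| <= M * `|x|.
Proof. by move=> M0 TM x; apply: supnorm_le => //; rewrite mulr_ge0. Qed.

End NullSequenceOperators.

Section ClopenTransfer.
Context (R : realType) (X : compactType) (A : set X) (cA : clopen A).
Local Notation CX := (cfun_type R X).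
Local Notation CA := (cfun_type R (clopen_type cA)).

Definition restriction_fun (f : CX) : clopen_type cA -> R := fun x => f (val x).

Lemma restriction_continuous f : continuous (restriction_fun f).
Proof.
move=> x; apply: continuous_comp; last exact: cts_fun.
exact: (@initial_continuous _ _ (set_val : A -> X)).
Qed.

Definition restriction (f : CX) : CA := mkcts (@restriction_continuous f).

Lemma restriction_linear : linear restriction.
Proof. by move=> a f g; apply/continuousEP. Qed.
HB.instance Definition _ :=
  GRing.isLinear.Build R CX CA _ restriction restriction_linear.

Lemma restrictionE f x : restriction f x = f (val x). Proof. by []. Qed.

Lemma norm_restriction f : `|restriction f| <= `|cutoff A f|.
Proof.
apply: cfun_norm_le => // x; rewrite restrictionE.
have Ax : A (val x) := set_valP x.
by rewrite -(cutoffT f cA Ax); exact: cfun_norm_ub.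
Qed.

Definition zero_extension_fun (g : CA) : X -> R := fun x =>
  if pselect (A x) is left Ax then g (exist _ x (mem_set Ax)) else 0.

Lemma zero_extensionT g x (Ax : A x) :
  zero_extension_fun g x = g (exist _ x (mem_set Ax)).
Proof.
rewrite /zero_extension_fun; case: pselect => // Ax'.
by congr (g _); apply: val_inj.
Qed.

Lemma zero_extensionN g x : ~ A x -> zero_extension_fun g x = 0.
Proof. by rewrite /zero_extension_fun; case: pselect. Qed.

Lemma zero_extension_continuous g : continuous (zero_extension_fun g).
Proof.
move=> x; have [Ax|nAx] := pselect (A x); last first.
  apply: (@continuous_at_near _ _ _ (fun=> 0) (~` A)) => //.
  - exact: closed_openC cA.2.
  - by move=> y /set_mem; exact: zero_extensionN.
  - exact: cvg_cst.
move=> V /=; rewrite (zero_extensionT g Ax) => nV.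
have [_ [[W oW <-] Wx] sWV] := @cts_fun _ _ g (exist _ x (mem_set Ax)) V nV.
have nW : nbhs x (W `&` A) by apply: filterI; apply: open_nbhs_nbhs;
  split => //; exact: cA.1.
apply: filterS nW => y [Wy Ay]; rewrite /= (zero_extensionT g Ay).
exact: sWV.
Qed.

Definition zero_extension (g : CA) : CX := mkcts (@zero_extension_continuous g).

Lemma zero_extension_linear : linear zero_extension.
Proof.
move=> a f g; apply/continuousEP => x; rewrite cfunD cfunZ /=.
rewrite /mkcts; have [Ax|nAx] := pselect (A x).
  by rewrite !(zero_extensionT _ Ax).
by rewrite !zero_extensionN// mulr0 addr0.
Qed.
HB.instance Definition _ :=
  GRing.isLinear.Build R CA CX _ zero_extension zero_extension_linear.

Lemma zero_extension_restriction f : zero_extension (restriction f) = cutoff A f.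
Proof.
apply/continuousEP => x; have [Ax|nAx] := pselect (A x).
  by rewrite cutoffT//= /mkcts zero_extensionT.
by rewrite cutoffN//= /mkcts zero_extensionN.
Qed.

Lemma cutoff_zero_extension g : cutoff A (zero_extension g) = zero_extension g.
Proof.
apply/continuousEP => x; have [Ax|nAx] := pselect (A x);
  first by rewrite cutoffT.
by rewrite cutoffN//= /mkcts zero_extensionN.
Qed.

Lemma norm_zero_extension g : `|zero_extension g| <= `|g|.
Proof.
apply: cfun_norm_le => // x; rewrite /= /mkcts.
have [Ax|nAx] := pselect (A x).
  by rewrite (zero_extensionT _ Ax); exact: cfun_norm_ub.
by rewrite zero_extensionN// normr0.
Qed.

End ClopenTransfer.

(** * Extension over one clopen piece *)

Section LocalExtension.
Context (R : realType) (K L : compactType) (phi : continuousType K L).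
Hypothesis surj_phi : set_surj [set: K] [set: L] phi.
Local Notation CK := (cfun_type R K).
Local Notation CL := (cfun_type R L).

Variables (A : set L) (cA : clopen A).
Let psi := restrict_preimage phi cA.

Let surj_psi : set_surj setT setT psi.
Proof.
move=> y _; have [x _ phix] := surj_phi (I : [set: L] (val y)).
have Ax : (phi @^-1` A) x by rewrite /preimage/= phix; exact: set_valP.
by exists (exist _ x (mem_set Ax)) => //; apply: val_inj.
Qed.

(** The extension property bounds the extended functionals only by the supremum
    of the norms of all the tau n on A. Dividing tau n by s n, which is at least
    delta, keeps the sequence weak-star null and makes all these norms at most
    1; multiplying back afterwards gives a bound for each n separately. *)
Lemma local_extension (lambda M delta : R) (tau : nat -> {linear CL -> R^o}) :
  c0_extension_property (pullback_range R psi) lambda -> 0 <= lambda ->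
  0 <= M -> 0 < delta -> (forall n h, `|tau n h| <= M * `|h|) ->
  (forall h, (tau n h : R) @[n --> \oo] --> (0 : R)) ->
  exists V : nat -> {linear CK -> R^o},
    [/\ forall n h, V n (pullback R phi h) = tau n (cutoff A h),
        forall n f, `|V n f| <= lambda * (opnorm (tau n \o cutoff A) + delta) *
          `|cutoff (phi @^-1` A) f| &
        forall f, (V n f : R) @[n --> \oo] --> (0 : R)].
Proof.
move=> ext lambda0 M0 delta0 tauM tau0.
have btau n : norm_bounded (tau n) by exists M.
pose s n : R := opnorm (tau n \o cutoff A) + delta.
have opn0 n : 0 <= opnorm (tau n \o cutoff A).
  exact/opnorm_ge0/norm_bounded_cutoff.
have s0 n : 0 < s n by rewrite ltr_wpDl.
pose Y := subspace_type (pullback_range R psi).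
have /choice[g gP] : forall y : Y, exists g, pullback R psi g = val y.
  by move=> y; have /asboolP[g _ gy] := valP y; exists g.
have ginj (u v : cfun_type R (clopen_type cA)) :
    pullback R psi u = pullback R psi v -> u = v.
  move=> uv; apply/continuousEP => y.
  by have [x _ <-] := surj_psi (I : setT y); rewrite -!pullbackE uv.
have glin : linear g.
  move=> a y z; apply: ginj; rewrite gP.
  have -> : val (a *: y + z) = a *: val y + val z by rewrite linearP.
  by apply/continuousEP => x; rewrite cfunD cfunZ -!gP !pullbackE cfunD cfunZ.
have norm_g y : `|g y| = `|y| by rewrite -(norm_pullback surj_psi) gP.
pose t_fun n (y : Y) : R := (s n)^-1 * tau n (zero_extension (g y)).
have t_scalar n : scalar (t_fun n).
  move=> a y z; rewrite /t_fun glin !linearP.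
  have arith (p q : R) : (s n)^-1 * (a * p + q) = a * ((s n)^-1 * p) + (s n)^-1 * q.
    by ring.
  exact: arith.
have t_le n y : `|t_fun n y| <= `|y|.
  rewrite /t_fun normrM normfV (gtr0_norm (s0 n)) ler_pdivrMl//.
  rewrite -cutoff_zero_extension;
    apply: le_trans (opnorm_cutoff_ub _ _ (btau n)) _.
  apply: ler_pM => //; first by rewrite lerDl ltW.
  by rewrite -norm_g; exact: norm_zero_extension.
have t_cvg y : t_fun n y @[n --> \oo] --> 0.
  apply/norm_cvg0P; apply: (@squeeze_cvgr _ _ _ _ (cst 0)
    (fun n => delta^-1 * `|tau n (zero_extension (g y)) : R|)).
  - apply: nearW => n;
    rewrite normr_ge0 /t_fun normrM normfV (gtr0_norm (s0 n)).
    by rewrite ler_wpM2r// lef_pV2 ?posrE// lerDr.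
  - exact: cvg_cst.
  - have h := cvgMl_tmp (a := delta^-1) (cvg_norm (tau0 (zero_extension (g y)))).
    by rewrite normr0 mulr0 in h; exact: h.
have [T TE] := c0_operator (t := fun n => functional (t_scalar n)) t_cvg.
have T1 y : `|T y| <= 1 * `|y|.
  by apply: c0_operator_le => // n z; rewrite TE mul1r; exact: t_le.
have [|T' [/norm_boundedP bT' T'T T'le]] := ext T.
  by apply/norm_boundedP; exists 1.
have {}T'le : opnorm T' <= lambda.
  by apply: le_trans T'le _; rewrite -[leRHS]mulr1 ler_wpM2l// opnorm_le.
pose V_fun n (f : CK) : R := s n * val (T' (restriction (clopen_preimage phi cA) f)) n.
have V_scalar n : scalar (V_fun n).
  move=> a f h; rewrite /V_fun !linearP.
  have arith (p q : R) : s n * (a * p + q) = a * (s n * p) + s n * q by ring.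
  exact: arith.
exists (fun n => functional (V_scalar n)); split.
- move=> n h; rewrite [LHS]/(V_fun n _) /V_fun.
  pose u := restriction cA h.
  have yP : pullback R psi u \in pullback_range R psi by apply/asboolP;
    exists u.
  pose y : Y := exist (fun f => f \in pullback_range R psi) _ yP.
  have -> : restriction (clopen_preimage phi cA) (pullback R phi h) = val y.
    by apply/continuousEP.
  rewrite T'T TE [functional _ _]/(t_fun n _) /t_fun.
  have -> : g y = u by apply: ginj; rewrite gP.
  by rewrite mulrA divff ?gt_eqF// mul1r zero_extension_restriction.
- move=> n f; rewrite [X in `|X|]/(V_fun n f) /V_fun normrM (gtr0_norm (s0 n)).
  rewrite mulrAC -/(s n) mulrC ler_wpM2r//; first exact: ltW.
  apply: le_trans (supnorm_ub n (c0_ubounded _)) _.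
  apply: le_trans (opnorm_ub bT' _) _.
  apply: ler_pM => //; first exact: opnorm_ge0.
  exact: norm_restriction.
- move=> f; apply/norm_cvg0P.
  have sM n : s n <= M + delta.
    rewrite lerD2r; apply: opnorm_le => // h /=.
    by apply: le_trans (tauM _ _) _; rewrite ler_wpM2l// norm_cutoff_le.
  pose x := T' (restriction (clopen_preimage phi cA) f).
  apply: (@squeeze_cvgr _ _ _ _ (cst 0) (fun n => (M + delta) * `|val x n|)).
  - apply: nearW => n; rewrite normr_ge0 [X in `|X|]/(V_fun n f) /V_fun.
    by rewrite normrM (gtr0_norm (s0 n)) ler_wpM2r.
  - exact: cvg_cst.
  - have /asboolP x0 := valP x.
    have h := cvgMl_tmp (a := M + delta) (cvg_norm x0).
    by rewrite normr0 mulr0 in h; exact: h.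
Qed.

End LocalExtension.

(** * Finiteness from compactness *)

(** If no finite subfamily covers, the complements of the finite unions generate
    a proper filter on A without cluster point. *)
Lemma compact_seq_cover (T : topologicalType) (I : eqType) (A : set T)
    (U : I -> set T) :
  compact A -> (forall i, open (U i)) -> A `<=` \bigcup_i U i ->
  exists s : seq I, forall x, A x -> exists2 i, i \in s & U i x.
Proof.
move=> cA oU AU; apply: contrapT => ncov.
pose G (s : seq I) := A `&` [set x | forall i, i \in s -> ~ U i x].
pose F := filter_from setT G.
have FF : ProperFilter F.
  apply: filter_from_proper => [|s _].
    apply: filter_from_filter; first by exists [::].
    move=> s1 s2 _ _; exists (s1 ++ s2) => // x [Ax nU].
    by split; split => // i si; apply: nU; rewrite mem_cat si ?orbT.
  apply: contrapT => nG; apply: ncov; exists s => x Ax.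
  apply: contrapT => nU; apply: nG; exists x; split => // i si Uix.
  by apply: nU; exists i.
have [|p [Ap clp]] := cA F FF; first by exists [::] => // x [].
have [i _ Uip] := AU p Ap.
have [||x [nUx Ux]] := clp (G [:: i]) (U i).
- by exists [:: i].
- by apply: open_nbhs_nbhs.
- by have [_ /(_ i)] := nUx; apply => //; rewrite mem_head.
Qed.

Lemma locally_constant_finite (T : topologicalType) (r : T -> T) (A : set T) :
  hausdorff_space T -> continuous r -> clopen A -> compact A ->
  (forall x, A x -> exists U, [/\ open U, U x & forall y, U y -> r y = r x]) ->
  exists2 s : seq T, uniq s & (forall x, A x -> r x \in s) /\
    forall q, clopen (A `&` r @^-1` [set q]).
Proof.
move=> hT cr cA cptA rloc.
have /choice[U UP] : forall x, exists U : set T,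
    [/\ open U, A x -> U x & forall y, U y -> r y = r x].
  move=> x; have [/rloc[U [oU Ux rU]]|nAx] := pselect (A x); first by exists U.
  by exists set0; split => //; exact: open0.
have [|x Ax|s sU] := compact_seq_cover cptA (U := U).
- by move=> x; have [] := UP x.
- by exists x => //; have [_ + _] := UP x; exact.
exists (undup (map r s)); first exact: undup_uniq.
split=> [x /sU[y ys Uyx]|q].
  rewrite mem_undup; apply/mapP; exists y => //.
  by have [_ _] := UP y; exact.
split.
  rewrite openE => x [Ax rx].
  have [U' [oU Ux rU]] := rloc x Ax.
  apply: (@filterS _ _ _ (A `&` U')).
    by move=> y [Ay /rU ry]; split => //=; rewrite ry.
  by apply: filterI; apply: open_nbhs_nbhs; split => //; exact: cA.1.
apply: closedI; first exact: cA.2.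
apply: preimage_closed => [x _|]; first exact: cr.
exact/accessible_closed_set1/hausdorff_accessible.
Qed.

(** * The collapsing operator *)

Section FiniteRank.
Context (R : realType) (K : compactType).
Local Notation CK := (cfun_type R K).

(** Pointwise convergence to 0 on the finitely many vectors w q is enough for
    norm convergence on the finite rank operator cutoff A \o Q. *)
Lemma opnorm_finite_rank_cvg (U : nat -> {linear CK -> R^o}) (Q : {linear CK -> CK})
    (A : set K) (s : seq K) (w : K -> CK) :
  (forall n f, U n (cutoff A f) = U n f) ->
  (forall f, (U n f : R) @[n --> \oo] --> (0 : R)) ->
  (forall f : CK, cutoff A (Q f) = \sum_(q <- s) (f q : R) *: w q) ->
  opnorm (U n \o Q) @[n --> \oo] --> (0 : R).
Proof.
move=> Ucut U0 Qs.
have b n f : `|(U n \o Q) f| <= (\sum_(q <- s) `|U n (w q) : R|) * `|f|.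
  rewrite /= -Ucut Qs linear_sum mulr_suml.
  apply: le_trans (ler_norm_sum _ _ _) _; apply: ler_sum => q _.
  rewrite linearZ /= [X in `|X|]/(f q * U n (w q)) normrM mulrC ler_wpM2l//.
  exact: cfun_norm_ub.
have sum0 (s' : seq K) : (\sum_(q <- s') `|U n (w q) : R|) @[n --> \oo] --> (0 : R).
  elim: s' => [|q s' IH].
    rewrite (_ : (fun _ => _) = cst 0); [exact: cvg_cst|].
    by apply/funext => n; rewrite big_nil.
  rewrite (_ : (fun _ => _) = (fun n => `|U n (w q) : R|) \+
      (fun n => \sum_(q <- s') `|U n (w q) : R|)).
    by have h := cvgD (cvg_norm (U0 (w q))) IH; rewrite normr0 addr0 in h;
      exact: h.
  by apply/funext => n; rewrite big_cons.
apply: (@squeeze_cvgr _ _ _ _ (cst 0) (fun n => \sum_(q <- s) `|U n (w q) : R|)).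
- apply: nearW => n; rewrite opnorm_ge0/=; last by eexists; exact: b.
  by apply: opnorm_le => [|f]; [apply: sumr_ge0 => q _; exact: normr_ge0|exact: b].
- exact: cvg_cst.
- exact: sum0.
Qed.

End FiniteRank.

Section Collapse.
Context (R : realType) (d : Order.disp_t) (K : compactLineType d) (L : compactType).
Context (phi : continuousType K L).
Hypothesis surj_phi : set_surj [set: K] [set: L] phi.
Local Notation CK := (cfun_type R K).

(** P f is f \o r, for r a retraction onto the fibre F of the point outside U.
    A pullback is constant on F, hence sent to a constant, and r takes finitely
    many values over a clopen subset of U because it is locally constant there.
    If U is everything, P and ev are 0. *)
Lemma collapse_operator (U : set L) : is_subset1 (~` U) ->
  (forall l, U l -> exists A, [/\ clopen A, A l & A `<=` U]) ->
  exists (P : {linear CK -> CK}) (ev : {linear CK -> R^o}),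
  [/\ forall f, `|P f| <= `|f|, forall f, `|ev f| <= `|f|,
      forall h, P (pullback R phi h) = ev (pullback R phi h) *: cfun1 R K,
      forall A, clopen A -> A `<=` U -> exists (s : seq K) (w : K -> CK),
        forall f : CK, cutoff (phi @^-1` A) (P f) = \sum_(q <- s) (f q : R) *: w q &
      forall (f : CK) x, ~ U (phi x) -> P f x = f x].
Proof.
move=> U1 Uc.
have [[p nUp]|noU] := pselect (exists p, ~ U p); last first.
  pose P : {linear CK -> CK} := \0; pose ev : {linear CK -> R^o} := \0.
  have PE f : P f = 0 by [].
  have evE f : ev f = 0 by [].
  exists P, ev; split => [f|f|h|A cA AU|f x nUx].
  - by rewrite PE normr0.
  - by rewrite evE normr0.
  - by rewrite PE evE scale0r.
  - by exists [::], (fun=> 0) => f; rewrite big_nil PE linear0.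
  - by exfalso; apply: noU; exists (phi x).
pose F := phi @^-1` (~` U).
have oU : open U.
  rewrite openE => l Ul; have [A [[oA _] Al AU]] := Uc l Ul.
  by apply: filterS AU _; exact: open_nbhs_nbhs.
have cF : closed F.
  by apply: preimage_closed; [move=> x _; exact: cts_fun|exact: open_closedC].
have [q _ phiq] := surj_phi (I : setT p).
have Fq : F q by rewrite /F /preimage /= phiq.
have [||r [cr rF rid rloc]] := @compact_line_retraction d K F cF.
- by exists q.
- move=> x /contrapT Ux; have [A [cA Ax AU]] := Uc _ Ux.
  exists (phi @^-1` A); split => //; first exact: clopen_preimage.
  by apply/seteqP; split => // y [/AU].
pose r' : continuousType K K := mkcts cr.
pose P : {linear CK -> CK} := pullback R r'.
have ev_lin : scalar (fun f : CK => f q : R) by move=> a f g.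
have PE f x : P f x = f (r x) by [].
exists P, (functional ev_lin); split => [f|f|h|A cA AU|f x nUx].
- by apply: cfun_norm_le => // x; exact: (cfun_norm_ub f (r x)).
- exact: (cfun_norm_ub f q).
- apply/continuousEP => x; rewrite cfunZ PE pullbackE.
  have -> : cfun1 R K x = 1 by [].
  by rewrite mulr1 (U1 _ _ (rF x) Fq).
- have cpA := @clopen_preimage _ _ phi _ cA.
  have [||s us [rs cs]] := locally_constant_finite order_hausdorff cr cpA.
  - exact: subclosed_compact cpA.2 compact_setT _.
  - by move=> x Ax; apply: rloc => nUx; apply: nUx; exact: AU.
  exists s, (fun y => cutoff (phi @^-1` A `&` r @^-1` [set y]) (cfun1 R K)) => f.
  apply/continuousEP => x; rewrite cfun_sum.
  have [Ax|nAx] := pselect ((phi @^-1` A) x); last first.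
    by rewrite cutoffN// big1// => y _; rewrite cfunZ cutoffN ?mulr0// => -[].
  rewrite cutoffT// PE (bigD1_seq (r x)) ?rs//= cfunZ.
  rewrite (cutoffT _ (cs (r x)) (conj Ax erefl)).
  have -> : cfun1 R K x = 1 by [].
  rewrite mulr1 big1 ?addr0// => y /eqP yrx.
  by rewrite cfunZ cutoffN ?mulr0// => -[_ /= ryx]; apply: yrx.
- by rewrite PE rid.
Qed.

End Collapse.

(** * Functionals and disjoint families of clopen sets *)

Section DisjointFamily.
Context (R : realType) (X : compactType) (I : choiceType) (A_ : I -> set X).
Hypothesis clopA : forall i, clopen (A_ i).
Hypothesis disjA : forall i j x, A_ i x -> A_ j x -> i = j.
Local Notation CX := (cfun_type R X).

Definition finite_union (s : seq I) : set X :=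
  [set x | exists2 i, i \in s & A_ i x].

Lemma finite_union_nil : finite_union [::] = set0.
Proof. by apply/seteqP; split => x // -[]. Qed.

Lemma finite_union_cons i s : finite_union (i :: s) = A_ i `|` finite_union s.
Proof.
apply/seteqP; split=> x.
  move=> [j]; rewrite in_cons => /predU1P[->|js] Ajx; [by left|].
  by right; exists j.
move=> [Aix|[j js Ajx]]; first by exists i; rewrite ?mem_head.
by exists j; rewrite ?in_cons ?js ?orbT.
Qed.

Lemma finite_union_clopen s : clopen (finite_union s).
Proof.
elim: s => [|i s IH]; first by rewrite finite_union_nil; exact: clopen0.
by rewrite finite_union_cons; exact: clopenU.
Qed.

Lemma finite_union_disj i s : i \notin s -> A_ i `&` finite_union s = set0.
Proof.
move=> is_; apply/seteqP; split=> x // -[Ai [j js Aj]].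
by rewrite (disjA Ai Aj) js in is_.
Qed.

Lemma cutoff_finite_union_null (t : {linear CX -> R^o}) s :
  (forall i, i \in s -> forall f, t (cutoff (A_ i) f) = 0) ->
  forall f, t (cutoff (finite_union s) f) = 0.
Proof.
elim: s => [|i s IH] ts f;
  first by rewrite finite_union_nil cutoff_set0 linear0.
have cs := finite_union_clopen s; have cCi := clopenC set0 (clopA i).
have -> : finite_union (i :: s) = A_ i `|` (finite_union s `&` ~` A_ i).
  by rewrite finite_union_cons setUIr setUv setIT.
rewrite cutoff_setU//; last by rewrite setIC -setIA setICl setI0.
  rewrite linearD ts ?mem_head// -cutoff_setI// IH ?[0 + 0]addr0// => j js.
  by apply: ts; rewrite in_cons js orbT.
exact: clopenI.
Qed.

(** If s almost maximizes the mass of t on finite unions, adding one more piece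
    can only gain a mass of at most e. *)
Lemma opnorm_small_off_finite (t : {linear CX -> R^o}) (e : R) :
  norm_bounded t -> 0 < e ->
  exists s : seq I, forall i, i \notin s -> opnorm (t \o cutoff (A_ i)) <= e.
Proof.
move=> bt e0; pose N s := opnorm (t \o cutoff (finite_union s)).
have N_le s : N s <= opnorm t.
  apply: opnorm_le => [|f]; first exact: opnorm_ge0.
  apply: le_trans (opnorm_ub bt _) _.
  by rewrite ler_wpM2l ?opnorm_ge0// norm_cutoff_le.
have supN : has_sup (range N).
  by split; [exists (N [::]), [::]|exists (opnorm t) => _ [s _ <-]].
have [_ [s _ <-] Ns] := sup_adherent e0 supN.
exists s => i is_.
have h : opnorm (t \o cutoff (A_ i)) + N s <= N (i :: s).
  rewrite /N finite_union_cons; apply: opnorm_cutoffD => //.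
    exact: finite_union_clopen.
  exact: finite_union_disj.
have : N (i :: s) <= sup (range N).
  by apply: ub_le_sup; [case: supN|exists (i :: s)].
lra.
Qed.

(** The index set may be uncountable, but a sequence of functionals charges only
    countably many pieces: those that have mass more than 1 / (k + 1) for some
    n and k. *)
Lemma countable_support (t : nat -> {linear CX -> R^o}) :
  (forall n, norm_bounded (t n)) ->
  exists S : set I, countable S /\
    forall i, ~ S i -> forall n f, t n (cutoff (A_ i) f) = 0.
Proof.
move=> bt.
have /choice[s sP] : forall nk : nat * nat, exists s : seq I,
    forall i, i \notin s -> opnorm (t nk.1 \o cutoff (A_ i)) <= nk.2.+1%:R^-1.
  by move=> [n k]; apply: opnorm_small_off_finite => //; rewrite invr_gt0 ltr0n.
exists (\bigcup_nk [set i | i \in s nk]); split.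
  apply: bigcup_countable; first exact: countableP.
  by move=> nk _; apply/finite_set_countable; exact: finite_seq.
move=> i nSi n f; apply/eqP; rewrite -normr_le0.
have op0 : opnorm (t n \o cutoff (A_ i)) <= 0.
  apply/ler_addgt0Pr => e e0; rewrite add0r.
  have h : e^-1 < (Num.bound e^-1)%:R.
    by have := archi_boundP (ltW (_ : 0 < e^-1)); apply; rewrite invr_gt0.
  apply: (@le_trans _ _ (Num.bound e^-1).+1%:R^-1).
    apply: (sP (n, _)); apply/negP => si; apply: nSi;
      by exists (n, Num.bound e^-1).
  rewrite invf_ple ?posrE ?ltr0n//.
  by apply: le_trans (ltW h) _; rewrite ler_nat.
apply: le_trans (opnorm_cutoff_ub _ _ (bt n)) _.
exact: mulr_le0_ge0.
Qed.

End DisjointFamily.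

Lemma sum_geometric_le (R : realType) (eta : R) N : 0 <= eta ->
  \sum_(i < N) eta / 2 ^+ i.+1 <= eta.
Proof.
move=> eta0.
have -> : \sum_(i < N) eta / 2 ^+ i.+1 = eta - eta / 2 ^+ N.
  elim: N => [|N IH]; first by rewrite big_ord0 expr0 divr1 subrr.
  rewrite big_ord_recr/= IH exprS; field.
  by rewrite expf_neq0 ?pnatr_eq0.
by rewrite gerBl divr_ge0// exprn_ge0.
Qed.

(** * The extension theorem *)

Theorem theorem3p2 (R : realType) (d : Order.disp_t) (K : compactLineType d)
    (L : compactType) (hausL : hausdorff_space L)
    (phi : continuousType K L) (surj_phi : set_surj [set: K] [set: L] phi)
    (Gamma : Type) (L_ : Gamma -> set L)
    (disjL : trivIset [set: Gamma] L_)
    (clopL : forall gamma, clopen (L_ gamma))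
    (restL : is_subset1 ([set: L] `\` \bigcup_gamma L_ gamma))
    (lambda : R) (lambda2 : 2 <= lambda)
    (extL : forall gamma,
      c0_extension_property
        (pullback_range R (restrict_preimage phi (clopL gamma))) lambda)
    (epsilon : R) (epsilon0 : 0 < epsilon) :
  c0_extension_property (pullback_range R phi) (lambda + epsilon).
Proof.
have disjL' i j x : L_ i x -> L_ j x -> i = j.
  by move=> Lix Ljx; apply: disjL => //; exists x.
have lambda0 : 0 <= lambda by apply: le_trans lambda2.
move=> T /norm_boundedP bT; set M := opnorm T.
have M0 : 0 <= M by exact: opnorm_ge0.
have inY h : pullback R phi h \in pullback_range R phi by apply/asboolP;
  exists h.
pose y h : subspace_type (pullback_range R phi) :=
  exist (fun f => f \in pullback_range R phi) _ (inY h).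
have y_lin a h k : y (a *: h + k) = a *: y h + y k.
  by apply: val_inj; apply/continuousEP.
have y_onto z : exists h, y h = z.
  by have /asboolP[h _ hz] := valP z; exists h; exact: val_inj.
have tau_scalar n : scalar (fun h => coordinate T n (y h) : R).
  by move=> a h k; rewrite y_lin linearP.
pose tau n := functional (tau_scalar n).
have tauE n h : tau n h = val (T (y h)) n by [].
have tauM n h : `|tau n h| <= M * `|h|.
  apply: le_trans (coordinate_le T n (y h)) _.
  apply: le_trans (opnorm_ub bT _) _; rewrite ler_wpM2l//.
  by rewrite -(norm_pullback surj_phi).
have tau0 h : (tau n h : R) @[n --> \oo] --> (0 : R) by exact: coordinate_cvg.
have btau n : norm_bounded (tau n) by exists M.
suff [T' [T'tau T'le T'cvg]] : exists T' : nat -> {linear cfun_type R K -> R^o},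
    [/\ forall n h, T' n (pullback R phi h) = tau n h,
        forall n f, `|T' n f| <= (lambda + epsilon) * M * `|f| &
        forall f, (T' n f : R) @[n --> \oo] --> (0 : R)].
  have [S SE] := c0_operator T'cvg.
  have C0 : 0 <= (lambda + epsilon) * M by rewrite mulr_ge0// addr_ge0// ltW.
  have S_le f : `|S f| <= (lambda + epsilon) * M * `|f|.
    by apply: c0_operator_le => // n g; rewrite SE; exact: T'le.
  exists S; split; [|move=> z|exact: opnorm_le].
    by apply/norm_boundedP; exists ((lambda + epsilon) * M).
  have [h <-] := y_onto z; apply: val_inj; apply/funext => n.
  by rewrite SE -tauE -T'tau.
have [M_eq0|M_gt0] := eqVneq M 0.
  pose Z (n : nat) : {linear cfun_type R K -> R^o} := \0.
  have ZE n (f : cfun_type R K) : Z n f = 0 by [].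
  exists Z; split => [n h|n f|f].
  - rewrite ZE; apply/esym/eqP; rewrite -normr_le0;
    apply: le_trans (tauM n h) _.
    by rewrite M_eq0 mul0r.
  - by rewrite ZE normr0 M_eq0 mulr0 mul0r.
  - exact: cvg_cst.
have {}M_gt0 : 0 < M by rewrite lt_neqAle eq_sym M_gt0.
pose eta := epsilon * M / (lambda + 1).
have l1 : 0 < lambda + 1 by rewrite ltr_wpDl.
have eta0 : 0 < eta by rewrite divr_gt0// mulr_gt0.
suff [T' [T'tau T'le T'cvg]] : exists T' : nat -> {linear cfun_type R K -> R^o},
    [/\ forall n h, T' n (pullback R phi h) = tau n h,
        forall n f, `|T' n f| <= (lambda * (M + eta) + eta) * `|f| &
        forall f, (T' n f : R) @[n --> \oo] --> (0 : R)].
  exists T'; split => // n f; apply: le_trans (T'le n f) _; rewrite ler_wpM2r//.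
  rewrite le_eqVlt; apply/orP; left; apply/eqP; rewrite /eta; field.
  by rewrite gt_eqF.
(* Only the pieces with index in S carry mass; idx numbers them, and B i is the
   piece of number i, or empty. *)
have [S [cS S0]] :=
  @countable_support R L {classic Gamma} L_ clopL disjL' tau btau.
have /countable_injP[idx idx_inj] := cS.
pose U := \bigcup_gamma L_ gamma.
have U1 : is_subset1 (~` U) by rewrite -setTD.
have Uc l : U l -> exists A, [/\ clopen A, A l & A `<=` U].
  by move=> [g _ Lgl]; exists (L_ g); split => // x Lgx; exists g.
have [P [ev [P_norm ev_norm P_pull P_rank P_id]]] :=
  collapse_operator R surj_phi U1 Uc.
pose B i := [set l | exists g : {classic Gamma}, [/\ S g, idx g = i & L_ g l]].
have B_L g : S g -> B (idx g) = L_ g.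
  move=> Sg; apply/seteqP; split=> [l [g' [Sg' gg' Lg'l]]|l Lgl];
    last by exists g.
  by rewrite -(idx_inj g' g)// inE.
have BP i : (exists2 g, S g & idx g = i) \/ B i = set0.
  have [h|nh] := pselect (exists2 g, S g & idx g = i); [by left|right].
  by apply/seteqP; split => // l [g [Sg gi _]]; apply: nh; exists g.
have clopB i : clopen (B i).
  by have [[g Sg <-]|->] := BP i; [rewrite B_L//|exact: clopen0].
have disjB i j x : B i x -> B j x -> i = j.
  by move=> [g [_ <- Lgx]] [g' [_ <- Lg'x]]; rewrite (disjL' _ _ _ Lgx Lg'x).
have BU i : B i `<=` U by move=> l [g [_ _ Lgl]]; exists g.
pose delta i : R := eta / 2 ^+ i.+1.
have delta_gt0 i : 0 < delta i by rewrite divr_gt0// exprn_gt0.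
have /choice[V VP] : forall i, exists V : nat -> {linear cfun_type R K -> R^o},
    [/\ forall n h, V n (pullback R phi h) = tau n (cutoff (B i) h),
        forall n f, `|V n f| <= lambda *
          (opnorm (tau n \o cutoff (B i)) + delta i) * `|cutoff (phi @^-1` B i) f| &
        forall f, (V n f : R) @[n --> \oo] --> (0 : R)].
  move=> i; have [[g Sg <-]|->] := BP i.
    rewrite B_L//; exact: (local_extension surj_phi (extL g)
       lambda0 M0 (delta_gt0 _) tauM tau0).
  exists (fun=> \0); split => [n h|n f|f].
  - by rewrite cutoff_set0 linear0.
  - rewrite [X in `|X|](_ : _ = 0)// normr0 mulr_ge0// mulr_ge0//
      addr_ge0 ?(ltW (delta_gt0 _))//.
    exact/opnorm_ge0/norm_bounded_cutoff.
  - exact: cvg_cst.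
apply: (@glue_extensions _ _ _ _ surj_phi tau M M0 tauM tau0 B clopB disjB V
  lambda eta delta lambda2 eta0 _ _ _ _ _ P ev P_norm ev_norm P_pull).
- by move=> i; exact: ltW.
- by move=> N; exact/sum_geometric_le/ltW.
- by move=> i; have [] := VP i.
- by move=> i; have [] := VP i.
- by move=> i; have [] := VP i.
- move=> i; have [_ Vb V0] := VP i.
  have [s [w Pw]] := P_rank _ (clopB i) (BU i).
  apply: opnorm_finite_rank_cvg Pw => // n f.
  have cpB := @clopen_preimage _ _ phi _ (clopB i).
  apply/eqP; rewrite -subr_eq0 -linearB -normr_le0.
  apply: le_trans (Vb _ _) _.
  by rewrite linearB /= cutoff_setI// setIid subrr normr0 mulr0.
move=> f e e0.
(* C is compact and avoids the fibre of the exceptional point, so finitely many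
   pieces cover it; those outside S go to the massless set Z, the others have
   number less than N0. *)
pose C := [set x | e <= `|f x - P f x|].
have cC : closed C.
  apply: (@preimage_closed _ _ (fun x => `|(f - P f) x|) [set a | e <= a]).
    move=> x _; apply: continuous_comp; first exact: (@cts_fun _ _ (f - P f)).
    exact: norm_continuous.
  exact: closed_ge.
have [||x Cx|s sC] :=
  @compact_seq_cover K {classic Gamma} C (fun g => phi @^-1` L_ g).
- exact: subclosed_compact cC compact_setT _.
- by move=> g; exact: (@clopen_preimage _ _ phi _ (clopL g)).1.
- have [[g _ Lgx]|nU] := pselect (U (phi x)); first by exists g.
  by move: Cx; rewrite /C /= P_id// subrr normr0 leNgt e0.
pose N0 := (\max_(g <- s) idx g).+1.
pose Z := finite_union (L_ : {classic Gamma} -> set L) [seq g <- s | g \notin S].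
exists N0, Z; split.
- exact: finite_union_clopen.
- move=> n h; apply: cutoff_finite_union_null => // g.
  by rewrite mem_filter => /andP[/negP nSg _] k; apply: S0 => Sg; apply: nSg;
    rewrite inE.
- move=> i x [g]; rewrite mem_filter => /andP[nSg gs] Lgx [g' [Sg' _ Lg'x]].
  by move/negP: nSg; apply; apply/mem_set; rewrite (disjL' _ _ _ Lgx Lg'x).
- move=> x nZ rx; rewrite leNgt; apply/negP => /ltW /sC[g gs Lgx].
  have [Sg|nSg] := pselect (S g).
    apply: (rx (idx g)); last by rewrite B_L.
    by rewrite ltnS; exact: leq_bigmax_seq.
  by apply: nZ; exists g => //; rewrite mem_filter gs andbT;
    apply/negP => /set_mem.
Qed.
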